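(* Let a triply periodic minimal surface in $\mathcal D$ be given by normalized Weierstrass parameters $(a,b,t,\rho)$ with $-t<-a<-1<1<b<t$ and $\rho>0$. The eight branched values of its Gauss map are antipodal (i.e. form four antipodal pairs on the sphere) if and only if $a=b$.
   Context: Let $a,b,t,\rho$ be real with $-t<-a<-1<1<b<t$ and $\rho>0$, and put $(v_1,\dots,v_6)=(-t,-a,-1,1,b,t)$. On the upper half plane let $dh=-i\,[(z^2-1)(z^2-t^2)]^{-1/2}dz$, $G=i\rho\,(z+a)^{-1/2}(z-b)^{1/2}$, $\phi_1=G\,dh$, $\phi_2=dh/G$ (each factor $(z-v_k)^{\pm1/2}$ is the branch that is positive for $z>v_6$; the signs of $\phi_1,\phi_2$ are immaterial below). $G$ is the (stereographically projected) Gauss map. Let $I_k=\left|\int_{v_k}^{v_{k+1}}\phi_1\right|$ and $J_k=\left|\int_{v_k}^{v_{k+1}}\phi_2\right|$ for $1\le k\le5$. The parameters define a surface in $\mathcal D$ exactly when the period conditions $I_1+I_5=J_1+J_5$ and $I_2+I_4=J_2+J_4$ hold. In that case the map $z\mapsto \operatorname{Re}\int^z\left(\tfrac12(\phi_2-\phi_1),\tfrac i2(\phi_2+\phi_1),dh\right)$ sends the upper half plane to a minimal hexagon $S$ with vertices $V_k$ (images of $v_k$) which, up to congruence and dilation, lies in a box $[-A,A]\times[-B,B]\times[0,1]$, meets the planes $x=\pm A$, $y=\pm B$ orthogonally, and has the boundary segments $\{(x,0,0)\mid |x|\le A\}$ (image of the interval $v_6v_1$ through $\infty$) and $\{(0,y,1)\mid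 |y|\le B\}$ (image of $v_3v_4$). Rotations by $\pi$ about these segments and reflections in the lateral faces extend $S$ to a triply periodic minimal surface $\tilde\Sigma$ with lattice $\Lambda$ spanned by $(4A,0,0)$, $(0,4B,0)$, $(2A,2B,2)$ and quotient $\Sigma=\tilde\Sigma/\Lambda$ of genus 3. The Gauss map of $\Sigma$ has degree 2, and therefore has eight branched values. Under stereographic projection, the antipodal point of $z$ is $-1/\overline z$. *)

(* Defs.v *)
From HB Require Import structures.
From Stdlib Require Import Relation_Operators.
From mathcomp Require Import all_boot all_order all_algebra.
From mathcomp Require Import all_classical all_reals all_analysis.
From mathcomp Require Import complex.

Set Implicit Arguments.
Unset Strict Implicit.
Unset Printing Implicit Defensive.

Import Order.TTheory GRing.Theory Num.Theory numFieldNormedType.Exports.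

Local Open Scope classical_set_scope.
Local Open Scope ring_scope.
Local Open Scope complex_scope.
Local Open Scope quotient_scope.

Section WeierstrassData.
Variable R : realType.
Variables a b t rho : R.

(* v_1, ..., v_6; the index 0 is a dummy. *)
Definition vertex (k : nat) : R := [:: 0; - t; - a; -1; 1; b; t]`_k.

(* On the closed upper half plane [sqrtc] takes its values in the closed first
   quadrant, so [sqrtc (z - v)] is the branch of (z - v)^(1/2) that is positive
   for real z > v, extended continuously to the real line. *)
Definition dh (z : R[i]) : R[i] :=
  - 'i / (sqrtc (z - 1) * sqrtc (z + 1) * sqrtc (z - t%:C) * sqrtc (z + t%:C)).

Definition G (z : R[i]) : R[i] :=
  'i * rho%:C * (sqrtc (z + a%:C))^-1 * sqrtc (z - b%:C).

Definition phi1 (z : R[i]) : R[i] := G z * dh z.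
Definition phi2 (z : R[i]) : R[i] := dh z / G z.

(* All the improper integrals below converge absolutely. *)
Definition integral_real_axis (D : set R) (f : R[i] -> R[i]) : R[i] :=
  (\int[lebesgue_measure]_(x in D) complex.Re (f x%:C)) +i*
  (\int[lebesgue_measure]_(x in D) complex.Im (f x%:C)).

(* The norm of R[i] is R[i]-valued, with nonnegative real values. *)
Definition I_ (k : nat) : R[i] :=
  `|integral_real_axis `]vertex k, vertex k.+1[ phi1|.
Definition J_ (k : nat) : R[i] :=
  `|integral_real_axis `]vertex k, vertex k.+1[ phi2|.

Definition period_conditions : Prop :=
  I_ 1 + I_ 5 = J_ 1 + J_ 5 /\ I_ 2 + I_ 4 = J_ 2 + J_ 4.

(* The box [-A, A] x [-B, B] x [0, 1] containing the hexagon S once the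
   Weierstrass map is divided by the height of its image: A and B are half the
   lengths of the two straight boundary segments. *)
Definition height : R := `|complex.Re (integral_real_axis `]1, t[ dh)|.
Definition A_ : R :=
  `|complex.Re (integral_real_axis (`]t, +oo[ `|` `]-oo, - t[)
          (fun z => (phi2 z - phi1 z) / 2))| / (2 * height).
Definition B_ : R :=
  `|complex.Re (integral_real_axis `]-1, 1[
          (fun z => 'i / 2 * (phi2 z + phi1 z)))| / (2 * height).

Definition vec3 (x y z : R) : 'rV[R]_3 := \row_(i < 3) [:: x; y; z]`_i.

(* The isometry x |-> x *m g.1 + g.2 of R^3. *)
Definition isometry : Type := ('M[R]_3 * 'rV[R]_3)%type.

Definition isometry_comp (g h : isometry) : isometry :=
  (h.1 *m g.1, h.2 *m g.1 + g.2).

Definition translation (l : 'rV[R]_3) : isometry := (1%:M, l).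

(* The symmetry of the k-th boundary arc v_k v_(k+1) of S.  The signs follow
   from the Weierstrass representation: x decreases from V_6 = (A, 0, 0) to
   V_1 = (-A, 0, 0), and y increases from V_3 = (0, -B, 1) to V_4 = (0, B, 1). *)
Definition edge_symmetry (k : nat) : isometry :=
  match k with
  | 1 => (diag_mx (vec3 (-1) 1 1), vec3 (- 2 * A_) 0 0) (* plane x = -A *)
  | 2 => (diag_mx (vec3 1 (-1) 1), vec3 0 (- 2 * B_) 0) (* plane y = -B *)
  | 3 => (diag_mx (vec3 (-1) 1 (-1)), vec3 0 0 2)       (* line (0, y, 1) *)
  | 4 => (diag_mx (vec3 1 (-1) 1), vec3 0 (2 * B_) 0)   (* plane y = B *)
  | 5 => (diag_mx (vec3 (-1) 1 1), vec3 (2 * A_) 0 0)   (* plane x = A *)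
  | 6 => (diag_mx (vec3 1 (-1) (-1)), 0)                (* line (x, 0, 0) *)
  | _ => translation 0
  end.

(* The generators are involutions, so the monoid they generate is a group. *)
Inductive symmetry_group : set isometry :=
| Gamma1 : symmetry_group (translation 0)
| GammaM g k : symmetry_group g -> (0 < k <= 6)%N ->
    symmetry_group (isometry_comp g (edge_symmetry k)).

Definition lattice : set 'rV[R]_3 :=
  [set l | exists m n p : int,
     l = vec3 (4 * A_) 0 0 *~ m + vec3 0 (4 * B_) 0 *~ n
         + vec3 (2 * A_) (2 * B_) 2 *~ p].

(* The closed upper half plane together with infinity ([None]): the parameter
   domain of the closed hexagon S. *)
Definition half_plane : set (R * R) := [set z | 0 <= z.2].
Definition hexagon : Type := one_point_compactification half_plane.
HB.instance Definition _ := Topological.on hexagon.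

Definition affix (z : half_plane) : R[i] := (set_val z).1 +i* (set_val z).2.

Definition edge (k : nat) : set hexagon :=
  match k with
  | 6 => [set z | if z is Some w then
                    complex.Im (affix w) = 0 /\
                    (t <= complex.Re (affix w) \/ complex.Re (affix w) <= - t)
                  else True]
  | _ => [set z | (0 < k < 6)%N /\
                  (if z is Some w then
                     complex.Im (affix w) = 0 /\
                     vertex k <= complex.Re (affix w) <= vertex k.+1
                   else False)]
  end.

(* The disjoint union of the copies g(S), g in the symmetry group. *)
Definition copies : Type := {_ : symmetry_group & hexagon}.
HB.instance Definition _ := Topological.on copies.

(* g(S) and (g o s)(S) are glued along the arc fixed by the edge symmetry s;
   this yields the periodic surface.  Then points that differ by a lattice
   translation are identified. *)
Definition glue_step (p q : copies) : Prop :=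
  projT2 p = projT2 q /\
  ((exists k, edge k (projT2 p) /\
      set_val (projT1 q) =
        isometry_comp (set_val (projT1 p)) (edge_symmetry k)) \/
   (exists l, lattice l /\
      set_val (projT1 q) =
        isometry_comp (translation l) (set_val (projT1 p)))).

Definition glue : rel copies :=
  fun p q => `[< clos_refl_sym_trans copies glue_step p q >].

Lemma glue_equiv_class : equiv_class_of glue.
Proof.
split=> [p | p q | q p r]; first by apply/asboolP/rst_refl.
  by apply/asboolP/asboolP; exact: rst_sym.
by move=> /asboolP pq /asboolP qr; apply/asboolP/(rst_trans _ _ _ q).
Qed.

Canonical glue_equiv := EquivRelPack glue_equiv_class.

Definition Sigma : Type := quotient_topology {eq_quot glue_equiv}.
HB.instance Definition _ := Topological.on Sigma.
HB.instance Definition _ := Quotient.on Sigma.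

(* G with values in the Riemann sphere, [None] being infinity. *)
Definition G_extended (z : hexagon) : option R[i] :=
  if z is Some w then
    if affix w == - a%:C then None else Some (G (affix w))
  else Some ('i * rho%:C).

(* Inverse of the stereographic projection from the north pole. *)
Definition inv_stereo (w : option R[i]) : 'rV[R]_3 :=
  if w is Some (x +i* y) then
    (x ^+ 2 + y ^+ 2 + 1)^-1 *: vec3 (2 * x) (2 * y) (x ^+ 2 + y ^+ 2 - 1)
  else vec3 0 0 1.

(* The unit normal transported to the copy g(S) is the image of the unit normal
   under the linear part of g, up to sign.  A rotation about a line in the
   surface reverses the transported normal, a reflection in an orthogonal plane
   preserves it; the lines being horizontal and the planes vertical, the sign
   is the (3,3) entry of the linear part. *)
Definition copies_normal (p : copies) : 'rV[R]_3 :=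
  let g := set_val (projT1 p) in
  g.1 ord_max ord_max *: (inv_stereo (G_extended (projT2 p)) *m g.1).

(* When - t < - a < -1 and 1 < b < t, the choice of a representative is
   immaterial: on each boundary arc G is real or imaginary, and [copies_normal]
   is invariant under [glue_step]. *)
Definition gauss_map (p : Sigma) : 'rV[R]_3 := copies_normal (repr p).

End WeierstrassData.

(* For a nonconstant holomorphic map these are the points of multiplicity at
   least 2. *)
Definition branch_point (X : topologicalType) (Y : Type) (f : X -> Y) (p : X) :=
  ~ exists2 U : set X, nbhs p U & {in U &, injective f}.

Definition branched_values (X : topologicalType) (Y : Type) (f : X -> Y) :
    set Y := f @` branch_point f.

(* V consists of the 2n distinct points w_1, -w_1, ..., w_n, -w_n. *)
Definition antipodal_pairs (R : realType) (n : nat) (V : set 'rV[R]_3) : Prop :=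
  exists w : 'I_n -> 'rV[R]_3,
    let f (ie : 'I_n * bool) := (-1) ^+ ie.2 *: w ie.1 in
    injective f /\ V = range f.

(* Main.v *)
Require Import Defs.
From Stdlib Require Import Relation_Operators.
From mathcomp Require Import all_boot all_order all_algebra.
From mathcomp Require Import all_classical all_reals all_analysis.
From mathcomp Require Import measurable_realfun.
From mathcomp Require Import complex zify ring lra.
Import Order.TTheory GRing.Theory Num.Theory numFieldNormedType.Exports.
Local Open Scope classical_set_scope.
Local Open Scope ring_scope.

Set Implicit Arguments.
Unset Strict Implicit.
Unset Printing Implicit Defensive.

(* Write G = i rho (p + i q) with (p + i q)^2 (z + a) = z - b. On the closed
   upper half plane p, q >= 0, so the normal maps the hexagon injectively into
   a quarter of the sphere, bounded by the half great circles that carry the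
   real and the imaginary values of G. Each edge symmetry acts on the normal as
   the reflection in the great circle containing the normals along the edge, so
   the Gauss map is injective near every point lying on at most one edge of
   each of the two kinds. At v_1, v_3, v_4 and v_6 two edges of the same kind
   meet; the product of their symmetries has linear part -1, which fixes all
   normals, and the Gauss map branches. With g_k = |G(v_k)| the branched values
   are therefore +-i g_1, +-i g_6, +-g_3, +-g_4, and they are antipodal if and
   only if g_1 g_6 = g_3 g_4 = 1. Eliminating rho from these two equations gives
   (t^2 - 1)(a^2 - b^2) = 0. Conversely, if a = b, then the reflection x |-> -x
   yields I_1 = rho^2 J_5 and I_5 = rho^2 J_1, so the first period condition
   forces rho = 1, and g_1 g_6 = g_3 g_4 = 1 follows. *)

(** * The normal along the hexagon *)

Section Coordinates.
Variable R : realType.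
Implicit Types x y z : R.

Lemma vec3_inj x y z x' y' z' :
  vec3 x y z = vec3 x' y' z' -> [/\ x = x', y = y' & z = z'].
Proof.
move=> /rowP e; split.
- by have := e (@Ordinal 3 0 isT); rewrite !mxE.
- by have := e (@Ordinal 3 1 isT); rewrite !mxE.
- by have := e (@Ordinal 3 2 isT); rewrite !mxE.
Qed.

Lemma vec3D x y z x' y' z' :
  vec3 x y z + vec3 x' y' z' = vec3 (x + x') (y + y') (z + z').
Proof. by apply/rowP => -[[|[|[|//]]] i]; rewrite !mxE. Qed.

Lemma vec3Z c x y z : c *: vec3 x y z = vec3 (c * x) (c * y) (c * z).
Proof. by apply/rowP => -[[|[|[|//]]] i]; rewrite !mxE. Qed.

Lemma vec3N x y z : - vec3 x y z = vec3 (- x) (- y) (- z).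
Proof. by apply/rowP => -[[|[|[|//]]] i]; rewrite !mxE. Qed.

Lemma vec3Mz x y z (m : int) :
  vec3 x y z *~ m = vec3 (x * m%:~R) (y * m%:~R) (z * m%:~R).
Proof. by rewrite -[LHS]scaler_int vec3Z ![m%:~R * _]mulrC. Qed.

Lemma vec3_diag x y z (d e f : R) :
  vec3 x y z *m diag_mx (vec3 d e f) = vec3 (x * d) (y * e) (z * f).
Proof.
by rewrite mul_mx_diag; apply/rowP => -[[|[|[|//]]] i]; rewrite !mxE.
Qed.

Lemma diag_vec3M x y z (d e f : R) :
  diag_mx (vec3 x y z) *m diag_mx (vec3 d e f)
  = diag_mx (vec3 (x * d) (y * e) (z * f)).
Proof.
rewrite mulmx_diag; congr diag_mx.
by apply/rowP => -[[|[|[|//]]] i]; rewrite !mxE.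
Qed.

Lemma diag_vec3_inj x y z (d e f : R) :
  diag_mx (vec3 x y z) = diag_mx (vec3 d e f) -> [/\ x = d, y = e & z = f].
Proof.
move=> /matrixP h; apply: vec3_inj; apply/rowP => i.
by have := h i i; rewrite !mxE eqxx !mulr1n.
Qed.

Lemma diag_vec3_max x y z : diag_mx (vec3 x y z) ord_max ord_max = z.
Proof. by rewrite !mxE eqxx mulr1n. Qed.

Lemma one_diag_vec3 : 1%:M = diag_mx (vec3 1 1 1) :> 'M[R]_3.
Proof.
apply/matrixP => i j; rewrite !mxE.
by case: i => -[|[|[|//]]] i.
Qed.

End Coordinates.

(** * Injectivity, signs and vertex values of the normal *)

Section Normal.
Variable R : realType.
Local Open Scope complex_scope.

(** The formula for [sqrtc] has a nonnegative real part, and its imaginary part carries the sign of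
    y (plus if y = 0), so the root lies in the closed first quadrant. *)
Lemma sqrtc_upper (x y : R) : 0 <= y -> exists p q : R,
  [/\ sqrtc (x +i* y) = p +i* q, 0 <= p, 0 <= q,
      p ^+ 2 - q ^+ 2 = x & 2 * p * q = y].
Proof.
move=> y0; set s := sqrtc _; exists (complex.Re s), (complex.Im s).
have := sqr_sqrtc (x +i* y); rewrite -/s; case E: s => [p q] /= [e1 e2].
move: E; rewrite /s /sqrtc /= => -[ep eq].
split => //; last first.
- by rewrite -e2; ring.
- rewrite -eq mulr_ge0 ?sqrtr_ge0//; case: eqP => // _; by rewrite sgr_ge0.
- by rewrite -ep sqrtr_ge0.
Qed.

Lemma sqrtc_ge0_real (x : R) : 0 <= x -> sqrtc x%:C = (Num.sqrt x)%:C.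
Proof. by move=> x0; rewrite sqrtc_sqrtr//= lecR. Qed.

Lemma sqrtc_le0_real (x : R) : x <= 0 -> sqrtc x%:C = 'i * (Num.sqrt (- x))%:C.
Proof.
move=> x0; rewrite /sqrtc /= eqxx expr0n /= addr0 sqrtr_sqr ler0_norm// mul1r.
rewrite addNr mul0r sqrtr0; simpc; congr (_ +i* Num.sqrt _); lra.
Qed.

Variables a b rho : R.
Hypotheses (ab : 0 < a + b) (rho0 : 0 < rho).

(* The last two equations say that (p + i q)^2 (z + a) = z - b for z = x + i y. *)
Lemma G_upper (x y : R) : 0 <= y -> x +i* y != - a%:C -> exists p q : R,
  [/\ G a b rho (x +i* y) = (- (rho * q)) +i* (rho * p), 0 <= p, 0 <= q,
      (p ^+ 2 - q ^+ 2) * (x + a) - 2 * p * q * y = x - b &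
      (p ^+ 2 - q ^+ 2) * y + 2 * p * q * (x + a) = y].
Proof.
move=> y0 xya; rewrite /G.
have -> : x +i* y + a%:C = (x + a) +i* y by simpc.
have -> : x +i* y - b%:C = (x - b) +i* y by simpc.
have [p2 [q2 [es2 p20 q20 ea eya]]] := sqrtc_upper (x + a) y0.
have [p1 [q1 [es1 p10 q10 eb eyb]]] := sqrtc_upper (x - b) y0.
rewrite es1 es2.
have nz : 0 < p2 ^+ 2 + q2 ^+ 2.
  rewrite lt0r addr_ge0 ?sqr_ge0// andbT; apply: contra xya.
  rewrite paddr_eq0 ?sqr_ge0// !sqrf_eq0 => /andP[/eqP p2e /eqP q2e].
  rewrite eq_complex /=; apply/andP; split; apply/eqP.
    by move: ea; rewrite p2e q2e expr0n /= => ea; lra.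
  by rewrite oppr0 -eya p2e; lra.
set n := p2 ^+ 2 + q2 ^+ 2 in nz.
(* The quotient (p1 + i q1) / (p2 + i q2), expanded with the conjugate of the denominator. *)
pose p := (p1 * p2 + q1 * q2) / n; pose q := (q1 * p2 - p1 * q2) / n.
have nz' : n != 0 by rewrite gt_eqF.
have pe : p * p2 - q * q2 = p1 by rewrite /p /q /n; field.
have qe : p * q2 + q * p2 = q1 by rewrite /p /q /n; field.
have eqc : (p2 +i* q2)^-1 * (p1 +i* q1) = p +i* q.
  have s0 : p2 +i* q2 != 0.
    apply/eqP => -[e2 e3]; move: nz; rewrite /n e2 e3; lra.
  apply: (mulfI s0); rewrite mulrA divff// mul1r; simpc.
  by rewrite -{1}pe -{1}qe; congr (_ +i* _); ring.
(* This says arg (z - b) >= arg (z + a). Otherwise p1 q2 > q1 p2, and p1 q1 = p2 q2 = y / 2 gives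
   p2^2 < p1^2 and q1^2 < q2^2, hence x + a < x - b, against a + b > 0. *)
have q0 : 0 <= q1 * p2 - p1 * q2.
  rewrite leNgt; apply/negP => h.
  have hp : 0 < p1 * q2 by apply: le_lt_trans (mulr_ge0 q10 p20) _; lra.
  have p1p : 0 < p1 by rewrite lt0r p10 andbT;
    apply: contraTneq hp => ->; rewrite mul0r ltxx.
  have q2p : 0 < q2 by rewrite lt0r q20 andbT;
    apply: contraTneq hp => ->; rewrite mulr0 ltxx.
  have e : p1 * q1 = p2 * q2 by lra.
  have h1 : p2 ^+ 2 < p1 ^+ 2.
    rewrite -(ltr_pM2r q2p).
    have -> : p2 ^+ 2 * q2 = p1 * (q1 * p2) by rewrite mulrA e; ring.
    have -> : p1 ^+ 2 * q2 = p1 * (p1 * q2) by ring.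
    by rewrite ltr_pM2l//; lra.
  have h2 : q1 ^+ 2 < q2 ^+ 2.
    rewrite -(ltr_pM2r p1p).
    have -> : q1 ^+ 2 * p1 = q2 * (q1 * p2).
      by rewrite expr2 -mulrA [q1 * p1]mulrC e; ring.
    have -> : q2 ^+ 2 * p1 = q2 * (p1 * q2) by ring.
    by rewrite ltr_pM2l//; lra.
  by have := ab; lra.
exists p, q; split.
- rewrite -[RHS]/(- (rho * q) +i* (rho * p)) -!mulrA [X in _ * (_ * X)]eqc; simpc.
  by [].
- by rewrite /p divr_ge0 ?addr_ge0 ?mulr_ge0 // ltW.
- by rewrite /q divr_ge0 // ltW.
- rewrite -ea -eya -eb -pe -qe; ring.
- rewrite -ea -{2}eyb -eya -pe -qe; ring.
Qed.

Definition half_plane_point (x y : R) (y0 : 0 <= y) : half_plane (R := R) :=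
  exist _ (x, y) (mem_set (y0 : half_plane (x, y))).

Lemma hexagonP (z : hexagon R) :
  z = None \/ exists (x y : R) (y0 : 0 <= y), z = Some (half_plane_point x y0).
Proof.
case: z => [[[x y] h]|]; [right|by left].
exists x, y, (set_mem h); congr Some; exact: val_inj.
Qed.

Lemma affix_half_plane_point (x y : R) (y0 : 0 <= y) :
  affix (half_plane_point x y0) = x +i* y.
Proof. by []. Qed.

Lemma half_plane_point_inj (x y x' y' : R) (y0 : 0 <= y) (y0' : 0 <= y') :
  x = x' -> y = y' -> half_plane_point x y0 = half_plane_point x' y0'.
Proof. by move=> ex ey; apply: val_inj; rewrite /= ex ey. Qed.

(** The height (m - 1) / (m + 1), with m = x^2 + y^2, determines m, and then the horizontal
    coordinates determine x and y; height 1 is taken at infinity only. *)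
Lemma inv_stereo_inj : injective (@inv_stereo R).
Proof.
have d0 (x y : R) : x ^+ 2 + y ^+ 2 + 1 != 0.
  by rewrite gt_eqF// ltr_wpDl// addr_ge0 ?sqr_ge0.
have top (x y : R) : inv_stereo (Some (x +i* y)) <> vec3 0 0 1.
  rewrite /= vec3Z => /vec3_inj[_ _] /(canRL (mulVKf (d0 x y))).
  by rewrite mulr1; lra.
move=> [[x y]|] [[x' y']|]; [|by move/top|by move/esym/top|by []].
rewrite /= !vec3Z => /vec3_inj[e1 e2 e3].
have h : x ^+ 2 + y ^+ 2 = x' ^+ 2 + y' ^+ 2.
  move: e3 (d0 x y) (d0 x' y').
  set m := x ^+ 2 + _; set n := x' ^+ 2 + _ => e3 m0 n0.
  have : (m - 1) * (n + 1) = (n - 1) * (m + 1).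
    have -> : m - 1 = (m + 1) * ((m + 1)^-1 * (m - 1)) by field.
    by rewrite e3; field.
  lra.
move: e1 e2; rewrite h => /(mulfI (invr_neq0 (d0 x' y'))) e1.
move=> /(mulfI (invr_neq0 (d0 x' y'))) e2.
by congr (Some (_ +i* _)); lra.
Qed.

Let N (z : hexagon R) := inv_stereo (G_extended a b rho z).

(** Up to the factor i rho, G is a square root of the Moebius map (z - b) / (z + a), so its value
    determines z. The value i rho at a finite z would mean (z - b) / (z + a) = 1, that is a + b =
    0. *)
Lemma G_extended_inj : injective (@G_extended R a b rho).
Proof.
have rho1 : rho != 0 by rewrite gt_eqF.
have inf (x y : R) (y0 : 0 <= y) :
    G_extended a b rho (Some (half_plane_point x y0)) <> Some ('i * rho%:C).
  rewrite /= affix_half_plane_point; case: (boolP (x +i* y == _)) => // xy.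
  have [p [q [-> p0 q0 e1 e2]]] := G_upper y0 xy.
  simpc; case=> /eqP; rewrite oppr_eq0 mulf_eq0 (negbTE rho1) /= => /eqP q00.
  rewrite -[X in _ = X]mulr1 => /(mulfI rho1) p1.
  by move: e1 ab; rewrite q00 p1; lra.
move=> z z'.
have [->|[x [y [y0 ->]]]] := hexagonP z.
  by have [->//|[x' [y' [y0' ->]]]] := hexagonP z' => /esym/inf.
have [->|[x' [y' [y0' ->]]]] := hexagonP z'; first by move/inf.
rewrite /= !affix_half_plane_point.
case: (boolP (x +i* y == _)) => xy; case: (boolP (x' +i* y' == _)) => xy' //.
  move=> _; move: xy; rewrite -(eqP xy') => /eqP[ex ey].
  by congr Some; exact: half_plane_point_inj.
have [p [q [-> p0 q0 e1 e2]]] := G_upper y0 xy.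
have [p' [q' [-> p0' q0' e1' e2']]] := G_upper y0' xy'.
case=> /oppr_inj /(mulfI rho1) eq /(mulfI rho1) ep; subst p' q'.
move: e1 e2 e1' e2'; set P := p ^+ 2 - _; set Q := 2 * p * q.
move=> e1 e2 e1' e2'.
(* Real and imaginary part of (P + i Q - 1) (z - z') = 0, the difference of the relations for z and
   z'. Again P + i Q = 1 would force a + b = 0. *)
have h1 : (P - 1) * (x - x') = Q * (y - y') by lra.
have h2 : (P - 1) * (y - y') = - Q * (x - x') by lra.
have D0 : 0 < (P - 1) ^+ 2 + Q ^+ 2.
  rewrite lt0r addr_ge0 ?sqr_ge0// andbT paddr_eq0 ?sqr_ge0// !sqrf_eq0.
  apply/negP => /andP[/eqP P1 /eqP Q0]; move: e1 ab; rewrite Q0; nra.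
have dx : ((P - 1) ^+ 2 + Q ^+ 2) * (x - x') = 0.
  rewrite mulrDl expr2 -mulrA h1 mulrCA h2; ring.
have dy : ((P - 1) ^+ 2 + Q ^+ 2) * (y - y') = 0.
  rewrite mulrDl expr2 -mulrA h2 mulrCA h1; ring.
move: dx dy => /eqP; rewrite mulf_eq0 (gt_eqF D0) /= subr_eq0 => /eqP ex.
move=> /eqP; rewrite mulf_eq0 (gt_eqF D0) /= subr_eq0 => /eqP ey.
by congr Some; exact: half_plane_point_inj.
Qed.

Lemma normal_inj : injective N.
Proof. exact: inj_comp inv_stereo_inj G_extended_inj. Qed.

(** The part of the extended real axis where G is imaginary, zero or infinite; on [y_arc] G is real,
    zero or infinite. The two arcs share the points -a and b. *)
Definition x_arc (z : hexagon R) : Prop :=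
  if z is Some w then complex.Im (affix w) = 0 /\
    (b <= complex.Re (affix w) \/ complex.Re (affix w) <= - a) else True.

Definition y_arc (z : hexagon R) : Prop :=
  if z is Some w then complex.Im (affix w) = 0 /\
    - a <= complex.Re (affix w) <= b else False.

(** Since G = - rho q + i rho p, the coordinate n1 is a negative multiple of q and n2 a positive
    multiple of p; q or p vanishes exactly where (p + i q)^2 is real of the appropriate sign. *)
Lemma normal_spec (z : hexagon R) : exists n1 n2 n3 : R,
  [/\ N z = vec3 n1 n2 n3, n1 <= 0, 0 <= n2, (n1 = 0 <-> x_arc z) &
      (n2 = 0 <-> y_arc z)].
Proof.
have [->|[x [y [y0 ->]]]] := hexagonP z.
  rewrite /N /=; simpc => /=; rewrite vec3Z; do 3 eexists; split; first by [].
  - by rewrite mulr0.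
  - rewrite mulr_ge0 ?invr_ge0 ?addr_ge0 ?sqr_ge0 ?mulr_ge0 ?ler0n// ltW//.
  - by split => // _; rewrite mulr0.
  - split=> // /eqP; rewrite gt_eqF// mulr_gt0 ?invr_gt0 ?mulr_gt0//.
    by rewrite ltr_wpDl// addr_ge0 ?sqr_ge0.
rewrite /N /= !affix_half_plane_point /=; case: ifPn => [/eqP[-> ->]|xy].
  exists 0, 0, 1; split => //; split => // _; split; rewrite ?oppr0 ?lexx//=.
    by right.
  by have := ab; lra.
have [p [q [-> p0 q0 e1 e2]]] := G_upper y0 xy.
have d0 : 0 < ((- (rho * q)) ^+ 2 + (rho * p) ^+ 2 + 1)^-1.
  by rewrite invr_gt0 ltr_wpDl// addr_ge0 ?sqr_ge0.
rewrite /= vec3Z; set d := (_ + 1)^-1 in d0 *.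
have q_eq : d * (2 * - (rho * q)) = 0 <-> q = 0.
  split=> [/eqP|->]; last by rewrite mulr0 oppr0 !mulr0.
  by rewrite mulf_eq0 gt_eqF//= mulf_eq0 pnatr_eq0/= oppr_eq0 mulf_eq0 gt_eqF// => /eqP.
have p_eq : d * (2 * (rho * p)) = 0 <-> p = 0.
  split=> [/eqP|->]; last by rewrite !mulr0.
  by rewrite mulf_eq0 gt_eqF//= mulf_eq0 pnatr_eq0/= mulf_eq0 gt_eqF// => /eqP.
have xa : y = 0 -> x + a != 0.
  move=> ye; apply: contra xy; rewrite ye addr_eq0 => /eqP ->.
  by rewrite eq_complex /= oppr0 !eqxx.
do 3 eexists; split; first by [].
- by rewrite mulrN mulrN oppr_le0 !mulr_ge0// ltW.
- by rewrite !mulr_ge0// ltW.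
- rewrite q_eq; split=> [qe|[ye h]].
    have ye : y = 0.
      apply/eqP; apply: contraT => yn0.
      have y1 : (p ^+ 2 - 1) * y = 0 by move: e2; rewrite qe; lra.
      move/eqP: y1; rewrite mulf_eq0 (negbTE yn0) orbF subr_eq0 => /eqP p1.
      by move: e1 ab; rewrite qe p1; lra.
    split => //; have [h|h] := leP x (- a); [by right|left].
    rewrite -subr_ge0 -e1 qe; have := ab; have := sqr_ge0 p; nra.
  move: e1 e2 (xa ye); rewrite ye => e1 e2 xan0.
  have pq : p * q = 0.
    have : (p * q) * (x + a) = 0 by lra.
    by move/eqP; rewrite mulf_eq0 (negbTE xan0) orbF => /eqP.
  move/eqP: pq; rewrite mulf_eq0 => /orP[|]/eqP // pe; move: e1; rewrite pe => e1.
  apply/eqP; rewrite -sqrf_eq0; apply/eqP; case: h => h.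
    have := ab; have := sqr_ge0 q; nra.
  have h' : x + a < 0 by rewrite lt_neqAle xan0; lra.
  have := ab; have := sqr_ge0 q; nra.
- rewrite p_eq; split=> [pe|[ye h]].
    have ye : y = 0 by move: e2; rewrite pe; have := ab; have := sqr_ge0 q; nra.
    split => //; move: e1 (xa ye); rewrite pe ye => e1 xan0.
    have [h|h] := ltP x (- a); first by have := ab; have := sqr_ge0 q; nra.
    by rewrite /= -subr_le0 -e1; have := ab; have := sqr_ge0 q; nra.
  move: e1 e2 (xa ye); rewrite ye => e1 e2 xan0.
  have pq : p * q = 0.
    have : (p * q) * (x + a) = 0 by lra.
    by move/eqP; rewrite mulf_eq0 (negbTE xan0) orbF => /eqP.
  move/eqP: pq; rewrite mulf_eq0 => /orP[|]/eqP // qe; move: e1; rewrite qe => e1.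
  apply/eqP; rewrite -sqrf_eq0; apply/eqP.
  have h' : 0 < x + a by rewrite lt_neqAle eq_sym xan0; lra.
  have := ab; have := sqr_ge0 p; nra.
Qed.

(** A positive (v - b) / (v + a) forces q = 0, so G(v) is imaginary of modulus g = rho p. In
    [normal_vertex_y] it is p that vanishes. *)
Lemma normal_vertex_x (v : R) : 0 < (v - b) / (v + a) -> exists g : R,
  [/\ 0 < g, g ^+ 2 = rho ^+ 2 * ((v - b) / (v + a)) &
   N (Some (half_plane_point v (lexx 0))) =
     vec3 0 (2 * g / (g ^+ 2 + 1)) ((g ^+ 2 - 1) / (g ^+ 2 + 1))].
Proof.
move=> h.
have va : v + a != 0 by apply: contraTneq h => ->; rewrite invr0 mulr0 ltxx.
have xy : v +i* 0 != - a%:C.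
  by apply: contra va => /eqP[-> _]; rewrite addNr.
rewrite /N /= affix_half_plane_point (negbTE xy).
have [p [q [-> p0 q0 e1 e2]]] := G_upper (lexx 0) xy.
have pq : p * q = 0.
  have : (p * q) * (v + a) = 0 by lra.
  by move/eqP; rewrite mulf_eq0 (negbTE va) orbF => /eqP.
have e3 : p ^+ 2 - q ^+ 2 = (v - b) / (v + a) by apply: (mulIf va); rewrite divfK//; lra.
have qe : q = 0.
  move/eqP: pq; rewrite mulf_eq0 => /orP[|]/eqP // pe.
  by move: h; rewrite -e3 pe; have := ab; have := sqr_ge0 q; lra.
exists (rho * p); split.
- rewrite mulr_gt0// lt0r p0 andbT; apply: contraTneq h => pe.
  by rewrite -e3 pe qe; lra.
- by rewrite -e3 qe; ring.
- rewrite /= vec3Z qe !(mulr0, oppr0, expr0n) /= ?sqrrN ?add0r ?addr0 ?mulr0.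
  by rewrite ?mulrN; congr vec3; rewrite [RHS]mulrC.
Qed.

Lemma normal_vertex_y (v : R) : (v - b) / (v + a) < 0 -> exists g : R,
  [/\ 0 < g, g ^+ 2 = rho ^+ 2 * ((b - v) / (v + a)) &
   N (Some (half_plane_point v (lexx 0))) =
     vec3 (- (2 * g / (g ^+ 2 + 1))) 0 ((g ^+ 2 - 1) / (g ^+ 2 + 1))].
Proof.
move=> h.
have va : v + a != 0 by apply: contraTneq h => ->; rewrite invr0 mulr0 ltxx.
have xy : v +i* 0 != - a%:C.
  by apply: contra va => /eqP[-> _]; rewrite addNr.
rewrite /N /= affix_half_plane_point (negbTE xy).
have [p [q [-> p0 q0 e1 e2]]] := G_upper (lexx 0) xy.
have pq : p * q = 0.
  have : (p * q) * (v + a) = 0 by lra.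
  by move/eqP; rewrite mulf_eq0 (negbTE va) orbF => /eqP.
have e3 : p ^+ 2 - q ^+ 2 = (v - b) / (v + a) by apply: (mulIf va); rewrite divfK//; lra.
have pe : p = 0.
  move/eqP: pq; rewrite mulf_eq0 => /orP[|]/eqP // qe.
  by move: h; rewrite -e3 qe; have := ab; have := sqr_ge0 p; lra.
exists (rho * q); split.
- rewrite mulr_gt0// lt0r q0 andbT; apply: contraTneq h => qe.
  by rewrite -e3 pe qe; lra.
- by rewrite -[b - v]opprB mulNr -e3 pe; ring.
- rewrite /= vec3Z pe !(mulr0, oppr0, expr0n) /= ?sqrrN ?add0r ?addr0 ?mulr0.
  by rewrite ?mulrN; congr vec3; [congr (- _)|]; rewrite [RHS]mulrC.
Qed.

End Normal.

(** * The closed hexagon and its edges *)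

Section Hexagon.
Variable R : realType.
Variables a b t : R.
Hypotheses (hta : - t < - a) (ha1 : - a < -1) (h1b : 1 < b) (hbt : b < t).

(** The vertices v_6 and v_1 divide the arc from b through infinity to -a into the edges 5, 6 and
    1. *)
Lemma x_arc_edges (z : hexagon R) :
  x_arc a b z <-> edge a b t 1 z \/ edge a b t 5 z \/ edge a b t 6 z.
Proof.
move: hta ha1 h1b hbt => h1 h2 h3 h4.
case: z => [w|] /=; last by split=> // _; right; right.
rewrite /vertex /=; move: (set_val w) => [x y] /=.
split=> [[-> [xb|xa]]|[[_ [-> h]]|[[_ [-> h]]|[-> h]]]].
- have [xt|xt] := leP x t; [right; left|right; right].
    by split=> //; split=> //; lra.
  by split=> //; left; lra.
- have [xt|xt] := leP (- t) x; [left|right; right].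
    by split=> //; split=> //; lra.
  by split=> //; right; lra.
- by split=> //; right; lra.
- by split=> //; left; lra.
- by split=> //; case: h => h; [left|right]; lra.
Qed.

Lemma y_arc_edges (z : hexagon R) :
  y_arc a b z <-> edge a b t 2 z \/ edge a b t 3 z \/ edge a b t 4 z.
Proof.
move: hta ha1 h1b hbt => h1 h2 h3 h4.
case: z => [w|] /=; last by split=> // -[[]|[[]|[]]].
rewrite /vertex /=; move: (set_val w) => [x y] /=.
split=> [[-> h]|[[_ [-> h]]|[[_ [-> h]]|[_ [-> h]]]]]; try by split=> //; lra.
have [x1|x1] := leP x (-1); first by left; split=> //; split=> //; lra.
have [x2|x2] := leP x 1; right; [left|right].
  by split=> //; split=> //; lra.
by split=> //; split=> //; lra.
Qed.

(* The edges along which G is imaginary (or infinite) and real, respectively: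
   the normal is orthogonal to the x-axis, respectively to the y-axis. *)
Definition x_index (k : nat) := k \in [:: 1; 5; 6]%N.
Definition y_index (k : nat) := k \in [:: 2; 3; 4]%N.

Lemma x_index_range (k : nat) : x_index k -> (0 < k <= 6)%N.
Proof. by rewrite /x_index !inE => /or3P[] /eqP->. Qed.

Lemma y_index_range (k : nat) : y_index k -> (0 < k <= 6)%N.
Proof. by rewrite /y_index !inE => /or3P[] /eqP->. Qed.

Lemma x_y_index (k : nat) : x_index k -> y_index k -> False.
Proof. by rewrite /x_index /y_index !inE => /or3P[] /eqP->. Qed.

Lemma edge_index (k : nat) (z : hexagon R) : edge a b t k z -> x_index k (+) y_index k.
Proof. by move: k => [|[|[|[|[|[|[|k]]]]]]] //= []. Qed.

Lemma edge_x_arc (k : nat) (z : hexagon R) : x_index k -> edge a b t k z -> x_arc a b z.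
Proof.
rewrite /x_index !inE => /or3P[] /eqP-> e; apply/x_arc_edges;
  by [left|right; left|right; right].
Qed.

Lemma edge_y_arc (k : nat) (z : hexagon R) : y_index k -> edge a b t k z -> y_arc a b z.
Proof.
rewrite /y_index !inE => /or3P[] /eqP-> e; apply/y_arc_edges;
  by [left|right; left|right; right].
Qed.

Lemma x_arc_edge (z : hexagon R) :
  x_arc a b z -> exists2 k, x_index k & edge a b t k z.
Proof. by move=> /x_arc_edges[e|[e|e]]; [exists 1%N|exists 5%N|exists 6%N]. Qed.

Lemma y_arc_edge (z : hexagon R) :
  y_arc a b z -> exists2 k, y_index k & edge a b t k z.
Proof. by move=> /y_arc_edges[e|[e|e]]; [exists 2%N|exists 3%N|exists 4%N]. Qed.

(** * Topology of the closed hexagon: the edges are closed *)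

Lemma continuous_half_plane_point (f g : R -> R) (g0 : forall r, 0 <= g r) :
  continuous f -> continuous g -> continuous (fun r => half_plane_point (f r) (g0 r)).
Proof.
move=> cf cg r U; rewrite nbhsE => -[B [[C oC <-] /= Cr] BU].
have cfg : (fun s => (f s, g s)) @ r --> (f r, g r).
  exact: cvg_pair (cf r) (cg r).
have : nbhs r ((fun s => (f s, g s)) @^-1` C).
  by apply: cfg; apply: open_nbhs_nbhs; split.
by apply: filterS => s Cs; exact: BU.
Qed.

Definition real_part (w : half_plane (R := R)) : R := (set_val w).1.
Definition imag_part (w : half_plane (R := R)) : R := (set_val w).2.

Lemma continuous_real_part : continuous real_part.
Proof.
move=> w; apply: (@continuous_comp _ _ _ set_val fst); last exact: cvg_fst.
exact: (@initial_continuous (half_plane (R := R)) _ set_val).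
Qed.

Lemma continuous_imag_part : continuous imag_part.
Proof.
move=> w; apply: (@continuous_comp _ _ _ set_val snd); last exact: cvg_snd.
exact: (@initial_continuous (half_plane (R := R)) _ set_val).
Qed.

Lemma closed_real_line (C : set R) : closed C ->
  closed [set w : half_plane (R := R) | imag_part w = 0 /\ C (real_part w)].
Proof.
move=> cC; apply: closedI.
  apply: (@preimage_closed _ _ imag_part [set y | y = 0]); last exact: closed_eq.
  by move=> w _; exact: continuous_imag_part.
apply: (@preimage_closed _ _ real_part C) => //.
by move=> w _; exact: continuous_real_part.
Qed.

(** A continuous image of [[l, r]]. Compactness makes the complement of the segment a neighbourhood
    of infinity. *)
Lemma compact_real_segment (l r : R) :
  compact [set w : half_plane (R := R) | imag_part w = 0 /\ l <= real_part w <= r].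
Proof.
have c : continuous (fun x : R => half_plane_point x (lexx (0 : R))).
  by apply: (@continuous_half_plane_point id (cst 0)) => x; [exact: cvg_id|exact: cvg_cst].
have := continuous_compact (continuous_subspaceT c) (@segment_compact R l r).
congr compact; apply/seteqP; split=> [w [x /= xlr <-]|w [y0 xlr]].
  by split=> //; rewrite in_itv in xlr.
exists (real_part w); first by rewrite /= in_itv.
apply: val_inj; rewrite [RHS]surjective_pairing; congr pair.
by rewrite -[RHS]/(imag_part w) y0.
Qed.

(** The edges 1 to 5 are closed and compact in the half plane, hence closed in its compactification.
    Edge 6 contains infinity, so its complement is an open subset of the half plane. *)
Lemma closed_edge (k : nat) : closed (edge a b t k).
Proof.
have bounded l r : closed [set z : hexagon R | if z is Some w then
    imag_part w = 0 /\ l <= real_part w <= r else False].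
  rewrite -openC; set K := [set w : half_plane (R := R) |
    imag_part w = 0 /\ l <= real_part w <= r].
  have clK : closed K.
    have -> : K = [set w | imag_part w = 0 /\
        ([set x | l <= x] `&` [set x | x <= r]) (real_part w)].
      by apply/seteqP; split=> w [w0 wlr]; split=> //; apply/andP.
    by apply: closed_real_line; apply: closedI; [exact: closed_ge|exact: closed_le].
  rewrite openE => -[w|] /= nz.
    have : nbhs w (~` K) by apply: open_nbhs_nbhs; split => //; rewrite openC.
    by apply: filterS.
  exists K; first by split => //; exact: compact_real_segment.
  by move=> z [[w nK <-]|->].
have [k6|] := boolP (0 < k < 6)%N.
  have := bounded (vertex a b t k) (vertex a b t k.+1); congr closed.
  move: k k6 => [|[|[|[|[|[|k]]]]]] // _; apply/seteqP; split=> -[w|] //=;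
    by move=> [].
have [->|k6 k06] := eqVneq k 6; last first.
  rewrite (_ : edge a b t k = set0); first exact: closed0.
  apply/seteqP; split=> // z.
  by move: k k6 k06 => [|[|[|[|[|[|[|k]]]]]]] // _ _ [].
move=> _; rewrite -openC; set K := [set w : half_plane (R := R) | imag_part w = 0 /\
  ([set x | t <= x] `|` [set x | x <= - t]) (real_part w)].
rewrite (_ : ~` _ = Some @` (~` K)).
  apply: one_point_compactification_open_some; rewrite openC.
  by apply: closed_real_line; apply: closedU; [exact: closed_ge|exact: closed_le].
apply/seteqP; split=> [[w|] //= nK|z [w nK <-//]].
  by exists w.
Qed.

(** With one index of each kind, these points will turn out not to be branch points. *)
Definition on_edges_only (i j : nat) : set (hexagon R) :=
  [set z | forall k, edge a b t k z -> k = i \/ k = j].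

Lemma open_on_edges_only (i j : nat) : open (on_edges_only i j).
Proof.
rewrite openE => z zij.
have nz k : nbhs z [set w | edge a b t k w -> k = i \/ k = j].
  have [kij|kij] := pselect (k = i \/ k = j).
    have -> : [set w | edge a b t k w -> k = i \/ k = j] = setT.
      by apply/seteqP; split=> [w _|w _ _]; [exact: I|exact: kij].
    by apply: open_nbhs_nbhs; split; [exact: openT|exact: I].
  have : nbhs z (~` edge a b t k).
    by apply: open_nbhs_nbhs; split; [rewrite openC; exact: closed_edge|move=> /zij].
  by apply: (@filterS _ _ (nbhs_filter z)) => w nw /nw.
(* Only six edges are nonempty, so six neighbourhoods have to be intersected. *)
have nI := @filterI _ _ (nbhs_filter z).
have := nI _ _ (nI _ _ (nz 1) (nz 2)) (nI _ _ (nI _ _ (nz 3) (nz 4))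
  (nI _ _ (nz 5) (nz 6))).
apply: (@filterS _ _ (nbhs_filter z)) => w [[h1 h2] [[h3 h4] [h5 h6]]] k.
by case: k => [|[|[|[|[|[|[|k]]]]]]] // [].
Qed.

Definition line_vertex (v : R) : hexagon R := Some (half_plane_point v (lexx 0)).

(** Edges of the same kind meet only at v_1, v_3, v_4 and v_6. Edges 1 and 2 meet at v_2, edges 4
    and 5 at v_5, and every other point lies on at most one edge; an index without an edge at the
    point is a filler. *)
Lemma arcs_cases (z : hexagon R) :
  (exists2 v, v \in [:: - t; -1; 1; t] & z = line_vertex v) \/
  exists i j, [/\ x_index i, y_index j & on_edges_only i j z].
Proof.
move: hta ha1 h1b hbt => h1 h2 h3 h4.
have [->|[x [y [y0 ->]]]] := hexagonP z.
  right; exists 6%N, 2%N; split=> // k.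
  by case: k => [|[|[|[|[|[|[|k]]]]]]] => [[]|[]|[]|[]|[]|[]|_|[]] //; left.
have [ye|yn0] := eqVneq y 0; last first.
  right; exists 6%N, 2%N; split=> // k.
  case: k => [|[|[|[|[|[|[|k]]]]]]] /= [] // => [_ []|_ []|_ []|_ []|_ []|] /eqP;
    by rewrite (negbTE yn0).
subst y; rewrite (_ : half_plane_point x y0 = half_plane_point x (lexx 0));
  last exact: half_plane_point_inj.
have vtx v : x = v -> v \in [:: - t; -1; 1; t] ->
  exists2 v, v \in [:: - t; -1; 1; t] & Some (half_plane_point x (lexx 0)) = line_vertex v.
  by move=> -> ?; exists v.
have arcs i j : x_index i -> y_index j ->
  (forall k, (0 < k < 6)%N -> vertex a b t k <= x <= vertex a b t k.+1 ->
     k = i \/ k = j) ->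
  (t <= x \/ x <= - t -> i = 6%N) ->
  exists i j, [/\ x_index i, y_index j &
    on_edges_only i j (Some (half_plane_point x (lexx 0)))].
  move=> xi yj h5 h6; exists i, j; split=> // k.
  case: k => [|[|[|[|[|[|[|k]]]]]]]; rewrite /edge /= => -[] //.
  1-5: by move=> _ [_] /h5; apply.
  by move=> _ /h6 ->; left.
have big k (P : Prop) : (0 < k < 6)%N -> (k = 1%N -> P) -> (k = 2%N -> P) ->
  (k = 3%N -> P) -> (k = 4%N -> P) -> (k = 5%N -> P) -> P.
  by case: k => [|[|[|[|[|[|k]]]]]] //; auto.
have [xt|xt|xt] := ltgtP x (- t); last by left; apply: (vtx _ xt); rewrite !inE eqxx.
  right; apply: (arcs 6 2)%N => // k k6; apply: (big k) => // ->;
    rewrite /vertex /= => h; try (by auto); exfalso; lra.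
have [x1|x1|x1] := ltgtP x (-1);
    last by left; apply: (vtx _ x1); rewrite !inE eqxx orbT.
  right; apply: (arcs 1 2)%N => //; last by move=> h; exfalso; lra.
  move=> k k6; apply: (big k) => // ->;
    rewrite /vertex /= => h; try (by auto); exfalso; lra.
have [x2|x2|x2] := ltgtP x 1;
    last by left; apply: (vtx _ x2); rewrite !inE eqxx !orbT.
  right; apply: (arcs 1 3)%N => //; last by move=> h; exfalso; lra.
  move=> k k6; apply: (big k) => // ->;
    rewrite /vertex /= => h; try (by auto); exfalso; lra.
have [x3|x3|x3] := ltgtP x t;
    last by left; apply: (vtx _ x3); rewrite !inE eqxx !orbT.
  right; apply: (arcs 5 4)%N => //; last by move=> h; exfalso; lra.
  move=> k k6; apply: (big k) => // ->;
    rewrite /vertex /= => h; try (by auto); exfalso; lra.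
right; apply: (arcs 6 2)%N => // k k6; apply: (big k) => // ->;
    rewrite /vertex /= => h; try (by auto); exfalso; lra.
Qed.

End Hexagon.

(** * The symmetry group modulo the lattice *)

Section Group.
Variable R : realType.

Definition sign_mx (al be ga : bool) : 'M[R]_3 :=
  diag_mx (vec3 ((-1) ^+ al) ((-1) ^+ be) ((-1) ^+ ga)).

Lemma sign_mxM al be ga al' be' ga' :
  sign_mx al be ga *m sign_mx al' be' ga' =
  sign_mx (al (+) al') (be (+) be') (ga (+) ga').
Proof. by rewrite /sign_mx diag_vec3M !signr_addb. Qed.

Lemma sign_mx_inj al be ga al' be' ga' :
  sign_mx al be ga = sign_mx al' be' ga' -> [/\ al = al', be = be' & ga = ga'].
Proof. by move=> /diag_vec3_inj[/signr_inj ? /signr_inj ? /signr_inj ?]. Qed.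

Lemma sign_mx0 : sign_mx false false false = 1%:M.
Proof. by rewrite /sign_mx !expr0 one_diag_vec3. Qed.

Lemma odd_abszD (x y : int) : odd `|x + y| = odd `|x| (+) odd `|y|.
Proof. lia. Qed.

(** Solves for lattice coefficients: m + p and m' + p' of equal parity give m' = m + 2 k + (p' - p),
    that is k times the first generator and p' - p times the third; likewise with n and the second
    generator. *)
Lemma odd_absz_eq (x y z w : int) : odd `|x + y| = odd `|z + w| ->
  exists k : int, z = x + (2 * k + (w - y)).
Proof. move=> h; exists ((z - x - (w - y)) %/ 2)%Z; lia. Qed.

Variables a b t rho : R.
Notation A := (A_ a b t rho).
Notation B := (B_ a b t rho).
Notation Gamma := (symmetry_group a b t rho).
Notation sym := (edge_symmetry a b t rho).

(* The translations 2 (m A, n B, p) with m, n, p of equal parity form the lattice,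
   so the parity conditions make the linear part determine the translation part
   modulo the lattice. *)
Definition parity_isometry (g : Defs.isometry R) := exists (al be ga : bool) (m n p : int),
  [/\ g = (sign_mx al be ga, vec3 (2 * A * m%:~R) (2 * B * n%:~R) (2 * p%:~R)),
      odd `|m + p| = al & odd `|n + p| = be (+) ga].

(** A linear part only changes signs of m, n and p, not their parities, so the parity conditions add
    up. *)
Lemma parity_isometry_comp g h : parity_isometry g -> parity_isometry h ->
  parity_isometry (isometry_comp g h).
Proof.
move=> [al [be [ga [m [n [p [-> e1 e2]]]]]]].
move=> [al' [be' [ga' [m' [n' [p' [-> e1' e2']]]]]]].
exists (al' (+) al), (be' (+) be), (ga' (+) ga).
exists ((-1) ^+ al * m' + m), ((-1) ^+ be * n' + n), ((-1) ^+ ga * p' + p).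
split.
- rewrite /isometry_comp /= sign_mxM vec3_diag vec3D; congr (_, vec3 _ _ _);
    by rewrite intrD intrM intr_sign; ring.
- transitivity (odd `|m' + p'| (+) odd `|m + p|); last by rewrite e1 e1'.
  by rewrite !odd_abszD !abszMsign; do 4 case: odd.
- transitivity (odd `|n' + p'| (+) odd `|n + p|); last by rewrite e2 e2' addbACA.
  by rewrite !odd_abszD !abszMsign; do 4 case: odd.
Qed.

Definition sym_x (k : nat) := k \in [:: 1; 3; 5]%N.
Definition sym_y (k : nat) := k \in [:: 2; 4; 6]%N.
Definition sym_z (k : nat) := k \in [:: 3; 6]%N.

Lemma edge_symmetry_linear (k : nat) : (0 < k <= 6)%N ->
  (sym k).1 = sign_mx (sym_x k) (sym_y k) (sym_z k).
Proof. by move: k => [|[|[|[|[|[|[|k]]]]]]]. Qed.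

Lemma parity_isometry_edge k : parity_isometry (sym k).
Proof.
have [k6|k6] := boolP (0 < k <= 6)%N; last first.
  (* Outside 1, ..., 6 [edge_symmetry] is the identity by default. *)
  exists false, false, false, 0, 0, 0; split=> //.
  rewrite sign_mx0 !mulr0; move: k k6 => [|[|[|[|[|[|[|k]]]]]]] //= _; congr pair;
  by apply/rowP => -[[|[|[|//]]] i]; rewrite !mxE.
exists (sym_x k), (sym_y k), (sym_z k); rewrite -edge_symmetry_linear //.
move: k k6 => [|[|[|[|[|[|[|k]]]]]]] //= _.
- exists (-1), 0, 0; split=> //; congr (_, vec3 _ _ _); lra.
- exists 0, (-1), 0; split=> //; congr (_, vec3 _ _ _); lra.
- exists 0, 0, 1; split=> //; congr (_, vec3 _ _ _); lra.
- exists 0, 1, 0; split=> //; congr (_, vec3 _ _ _); lra.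
- exists 1, 0, 0; split=> //; congr (_, vec3 _ _ _); lra.
- exists 0, 0, 0; split=> //; congr (_, _); rewrite !mulr0.
  by apply/rowP => -[[|[|[|//]]] i]; rewrite !mxE.
Qed.

Lemma symmetry_group_parity g : Gamma g -> parity_isometry g.
Proof.
elim=> [|h k _ ih _]; last exact/parity_isometry_comp/parity_isometry_edge.
(* Index 0 stands for the identity. *)
exact: (parity_isometry_edge 0).
Qed.

(** Hence in the quotient a copy of the hexagon is known by its linear part alone, one of eight sign
    matrices. *)
Lemma symmetry_group_lattice g h : Gamma g -> Gamma h -> g.1 = h.1 ->
  exists2 l, lattice a b t rho l & h = isometry_comp (translation l) g.
Proof.
move=> /symmetry_group_parity[al [be [ga [m [n [p [-> e1 e2]]]]]]].
move=> /symmetry_group_parity[al' [be' [ga' [m' [n' [p' [-> e1' e2']]]]]]].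
rewrite /= => /sign_mx_inj[eal ebe ega]; rewrite -eal -ebe -ega in e1' e2' *.
have [mm em] := odd_absz_eq (etrans e1 (esym e1')).
have [nn en] := odd_absz_eq (etrans e2 (esym e2')).
exists (vec3 (4 * A) 0 0 *~ mm + vec3 0 (4 * B) 0 *~ nn
         + vec3 (2 * A) (2 * B) 2 *~ (p' - p)); first by exists mm, nn, (p' - p).
rewrite /isometry_comp /translation /= !mulmx1; congr pair.
move: (A) (B) => AA BB.
rewrite !vec3Mz.
rewrite !vec3D.
rewrite em en.
rewrite !intrD !intrM !intrN.
congr vec3; ring.
Qed.

Lemma symmetry_group_edge g k : Gamma g -> (0 < k <= 6)%N ->
  Gamma (isometry_comp g (sym k)).
Proof. exact: GammaM. Qed.

End Group.

(** * Branch points of the Gauss map *)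

Section Surface.
Variable R : realType.
Variables a b t rho : R.
Hypotheses (hta : - t < - a) (ha1 : - a < -1) (h1b : 1 < b) (hbt : b < t).
Hypothesis (hrho : 0 < rho).
Local Open Scope quotient_scope.
Implicit Types p q : copies a b t rho.

Notation Gamma := (symmetry_group a b t rho).
Notation sym := (edge_symmetry a b t rho).
Notation S := (Sigma a b t rho).
Notation normal z := (inv_stereo (G_extended a b rho z)).
Notation edge := (edge a b t).

(** * Copies of the hexagon and the gluing relation *)

Definition copy (g : Defs.isometry R) (Gg : Gamma g) (z : hexagon R) : copies a b t rho :=
  existT _ (exist _ g (mem_set Gg)) z.

Definition linear_part (p : copies a b t rho) : 'M[R]_3 := (set_val (projT1 p)).1.

Lemma linear_part_copy g (Gg : Gamma g) z : linear_part (copy Gg z) = g.1.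
Proof. by []. Qed.

Lemma copyP (p : copies a b t rho) : exists g (Gg : Gamma g), p = copy Gg (projT2 p).
Proof.
case: p => -[g h] z; exists g, (set_mem h); congr existT; exact: val_inj.
Qed.

Lemma linear_partP p : exists al be ga, linear_part p = sign_mx R al be ga.
Proof.
have [g [Gg ->]] := copyP p; rewrite linear_part_copy.
have [al [be [ga [m [n [q [-> _ _]]]]]]] := symmetry_group_parity Gg.
by exists al, be, ga.
Qed.

Lemma edge_range k (z : hexagon R) : edge k z -> (0 < k <= 6)%N.
Proof. by move: k => [|[|[|[|[|[|[|k]]]]]]] // []. Qed.

(** What a gluing step does to the linear parts, with translations forgotten; invariants of the
    gluing are checked against this relation. *)
Definition adjacent (p q : copies a b t rho) :=
  projT2 p = projT2 q /\ (linear_part p = linear_part q \/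
    exists2 k, edge k (projT2 p) & linear_part q = (sym k).1 *m linear_part p).

Lemma glue_step_adjacent p q : glue_step p q -> adjacent p q.
Proof.
rewrite /adjacent /linear_part => -[-> [[k [ek ->]]|[l [_ ->]]]]; split=> //.
  by right; exists k.
by left; rewrite /isometry_comp /= mulmx1.
Qed.

Lemma adjacentC p q : adjacent p q -> adjacent q p.
Proof.
case=> pq [e|[k ek e]]; split; rewrite ?pq //; [by left|right; exists k].
  by rewrite -pq.
have [al [be [ga e']]] := linear_partP p.
rewrite e e' edge_symmetry_linear ?(edge_range ek)// !sign_mxM.
by rewrite !addbA !addbb.
Qed.

Lemma SigmaP p q : \pi_S p = \pi_S q <-> clos_refl_sym_trans _ (@glue_step R a b t rho) p q.
Proof.
split=> [/(@eqmodP _ (glue_equiv a b t rho))/asboolP//|pq].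
by apply/(@eqmodP _ (glue_equiv a b t rho))/asboolP.
Qed.

Lemma Sigma_invariant (T : Type) (f : copies a b t rho -> T) :
  (forall p q, adjacent p q -> f p = f q) ->
  forall p q, \pi_S p = \pi_S q -> f p = f q.
Proof.
move=> fadj p q /SigmaP; elim=> {p q}.
- by move=> p q /glue_step_adjacent/fadj.
- by [].
- by move=> p q _ ->.
- by move=> p q r _ -> _ ->.
Qed.

Lemma pi_lattice p q :
  projT2 p = projT2 q -> linear_part p = linear_part q -> \pi_S p = \pi_S q.
Proof.
move=> pq; have [g [Gg ep]] := copyP p; have [h [Gh eq]] := copyP q.
rewrite ep eq pq !linear_part_copy => /(symmetry_group_lattice Gg Gh)[l ll e].
apply/SigmaP/rst_step; split => //; right; exists l; split => //.
Qed.

(** Crossing an edge: the same point of the surface seen from the neighbouring copy. *)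
Lemma pi_edge p k : edge k (projT2 p) -> exists q,
  [/\ \pi_S q = \pi_S p, projT2 q = projT2 p &
      linear_part q = (sym k).1 *m linear_part p].
Proof.
move=> ek; have [g [Gg ep]] := copyP p.
exists (copy (symmetry_group_edge Gg (edge_range ek)) (projT2 p)); split=> //.
  apply/esym/SigmaP/rst_step; split=> //; left; exists k; split=> //.
  by rewrite [in RHS]ep.
by rewrite linear_part_copy ep linear_part_copy.
Qed.

Let ab : 0 < a + b.
Proof. by move: hta ha1 h1b hbt => *; lra. Qed.

(** On the third coordinate the two factors (-1)^ga cancel, so all copies of a point have normals of
    the same height. *)
Lemma copies_normalE p al be ga n1 n2 n3 : linear_part p = sign_mx R al be ga ->
  normal (projT2 p) = vec3 n1 n2 n3 ->
  copies_normal p = vec3 ((-1) ^+ (ga (+) al) * n1) ((-1) ^+ (ga (+) be) * n2) n3.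
Proof.
rewrite /linear_part /copies_normal => -> ->.
rewrite diag_vec3_max vec3_diag vec3Z !signr_addb; congr vec3.
- ring.
- ring.
- by rewrite mulrC -mulrA -signr_addb addbb mulr1.
Qed.

(** By [copies_normalE], crossing such an edge changes the sign of n1 alone; for the other kind of
    edge it is n2 alone. *)
Lemma x_index_sym k : x_index k ->
  [/\ sym_z k (+) sym_x k & sym_z k (+) sym_y k = false].
Proof. by rewrite /x_index !inE => /or3P[] /eqP->. Qed.

Lemma y_index_sym k : y_index k ->
  [/\ sym_z k (+) sym_x k = false & sym_z k (+) sym_y k].
Proof. by rewrite /y_index !inE => /or3P[] /eqP->. Qed.

(** The coordinate whose sign changes across an edge is 0 along that edge. *)
Lemma copies_normal_adjacent p q : adjacent p q -> copies_normal p = copies_normal q.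
Proof.
case=> pq; have [al [be [ga e]]] := linear_partP p.
have [n1 [n2 [n3 [en _ _ n10 n20]]]] := normal_spec ab hrho (projT2 p).
rewrite (copies_normalE e en) => -[e'|[k ek]].
  by rewrite e in e'; rewrite pq in en; rewrite (copies_normalE (esym e') en).
rewrite e edge_symmetry_linear ?(edge_range ek)// sign_mxM => e'.
have en' := en; rewrite pq in en'; rewrite (copies_normalE e' en').
rewrite (addbACA (sym_z k) ga (sym_x k)) (addbACA (sym_z k) ga (sym_y k)).
have := edge_index ek; case: (boolP (x_index k)) => [kx _|_ /= ky].
  have [-> ->] := x_index_sym kx.
  by rewrite (n10.2 (edge_x_arc hta ha1 h1b hbt kx ek)) !mulr0.
have [-> ->] := y_index_sym ky.
by rewrite (n20.2 (edge_y_arc hta ha1 h1b hbt ky ek)) !mulr0.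
Qed.

Lemma gauss_map_pi p : gauss_map (\pi_S p) = copies_normal p.
Proof.
apply: (Sigma_invariant copies_normal_adjacent); exact: reprK.
Qed.

(** * Local injectivity and branching of the Gauss map *)

Lemma signr_eq_ge0 (s s' : bool) (x y : R) : 0 <= x -> 0 <= y ->
  (-1) ^+ s * x = (-1) ^+ s' * y -> x = y /\ (s = s' \/ x = 0).
Proof.
by case: s s' => -[] x0 y0; rewrite ?expr0 ?expr1 => e;
  (split; [lra|first [by left|right; lra]]).
Qed.

(** Near p the surface is made of copies of the hexagon reflected across the edges i and j. Equal
    normals have equal |n1|, |n2| and n3, so the points of the hexagon agree by [normal_inj]. The
    signs determine the copy, unless n1 = 0 or n2 = 0; then the point lies on edge i or j, where the
    copies in question are glued. *)
Lemma not_branch_point i j p : x_index i -> y_index j ->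
  on_edges_only a b t i j (projT2 p) -> ~ branch_point (@gauss_map R a b t rho) (\pi_S p).
Proof.
move=> ix jy pij; apply; have [al [be [ga e0]]] := linear_partP p.
(* Linear part of the copy reached from that of p by crossing edge i if e holds and edge j if f
   holds. *)
pose L e f := sign_mx R (al (+) (e && sym_x i) (+) (f && sym_x j))
  (be (+) (e && sym_y i) (+) (f && sym_y j)) (ga (+) (e && sym_z i) (+) (f && sym_z j)).
have ir := x_index_range ix; have jr := y_index_range jy.
have hi (s x e u : bool) : s (+) (x (+) (e && s) (+) u) = x (+) (~~ e && s) (+) u.
  by case: s x e u => -[] [] [].
have hj (s x u f : bool) : s (+) (x (+) u (+) (f && s)) = x (+) u (+) (~~ f && s).
  by case: s x u f => -[] [] [].
have Li e f : (sym i).1 *m L e f = L (~~ e) f.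
  rewrite edge_symmetry_linear// /L sign_mxM.
  by rewrite !hi.
have Lj e f : (sym j).1 *m L e f = L e (~~ f).
  rewrite edge_symmetry_linear// /L sign_mxM.
  by rewrite !hj.
(* The candidate neighbourhood. [P] is stable under gluing, so its image is open once [P] is open on
   each copy. *)
pose P q := on_edges_only a b t i j (projT2 q) /\ exists e f, linear_part q = L e f.
have Pstep q q' : adjacent q q' -> P q -> P q'.
  move=> [qq eL] [qij [e [f eq]]]; split; first by rewrite -qq.
  case: eL => [<-|[k ek ->]].
    by exists e, f.
  by rewrite eq; have [->|->] := qij _ ek;
    [exists (~~ e), f; rewrite Li|exists e, (~~ f); rewrite Lj].
have Padj q q' : adjacent q q' -> P q = P q'.
  by move=> qq'; apply/propext; split; apply: Pstep => //; exact: adjacentC.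
exists [set \pi_S q | q in P].
  apply: open_nbhs_nbhs; split; last first.
    exists p => //; split=> //; exists false, false.
    by rewrite /L /= !addbF.
  rewrite /open /= /quotient_open (_ : _ @^-1` _ = P); last first.
    apply/seteqP; split=> [q [q' Pq' /(Sigma_invariant Padj) <-//]|q Pq].
    by exists q.
  apply/sigT_openP => g.
  have [h|h] := pselect (exists e f, (set_val g).1 = L e f); last first.
    rewrite (_ : _ @^-1` _ = set0); first exact: open0.
    by apply/seteqP; split=> // z [_ /h].
  rewrite (_ : _ @^-1` _ = on_edges_only a b t i j); first exact: open_on_edges_only.
  by apply/seteqP; split=> [z []|z zij].
move=> _ _ /set_mem[q [qij [e [f eq]]] <-] /set_mem[q' [qij' [e' [f' eq']]] <-].
have [n1 [n2 [n3 [en n1s n2s n10 n20]]]] := normal_spec ab hrho (projT2 q).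
have [m1 [m2 [m3 [em m1s m2s _ _]]]] := normal_spec ab hrho (projT2 q').
rewrite !gauss_map_pi (copies_normalE eq en) (copies_normalE eq' em).
move=> /vec3_inj[e1 e2 e3].
have [ix1 ix2] := x_index_sym ix; have [jy1 jy2] := y_index_sym jy.
have [nm1 s1] : - n1 = - m1 /\ (e = e' \/ - n1 = 0).
  have := @signr_eq_ge0 (ga (+) al (+) e) (ga (+) al (+) e') (- n1) (- m1).
  rewrite !oppr_ge0 !mulrN => /(_ n1s m1s)[]; last first.
    by move=> -> [/addbI ->|->]; split=> //; [left|right].
  congr (- _); move: e1 ix1 jy1.
  by clear; case: e e' => -[]; case: f f' => -[]; case: ga al => -[];
    do 2 case: (sym_z _); do 2 case: (sym_x _).
have [nm2 s2] : n2 = m2 /\ (f = f' \/ n2 = 0).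
  have := @signr_eq_ge0 (ga (+) be (+) f) (ga (+) be (+) f') n2 m2 n2s m2s.
  case; last by move=> -> [/addbI ->|->]; split=> //; [left|right].
  move: e2 ix2 jy2.
  by clear; case: e e' => -[]; case: f f' => -[]; case: ga be => -[];
    do 2 case: (sym_z _); do 2 case: (sym_y _).
have zz : projT2 q = projT2 q'.
  by apply: (normal_inj ab hrho); rewrite en em (oppr_inj nm1) nm2 e3.
(* If e and e' differ, then n1 = 0 and the point lies on an edge of the first kind, which can only
   be i; crossing it turns e into e'. *)
have [q1 [pq1 zq1 eq1]] : exists q1,
    [/\ \pi_S q1 = \pi_S q, projT2 q1 = projT2 q & linear_part q1 = L e' f].
  have [ee|/eqP ee] := eqVneq e e'; first by exists q; rewrite -ee.
  case: s1 => // /eqP; rewrite oppr_eq0 => /eqP /n10.1.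
  move=> /(x_arc_edge hta ha1 h1b hbt)[k kx ek].
  have ki : k = i.
    by have [//|kj] := qij _ ek; move: kx jy; rewrite kj => /x_y_index.
  rewrite ki in ek; have [q1 [? ? eq1]] := pi_edge ek.
  exists q1; split=> //; rewrite eq1 eq Li; congr L.
  by case: (e) (e') ee => -[].
have [q2 [pq2 zq2 eq2]] : exists q2,
    [/\ \pi_S q2 = \pi_S q1, projT2 q2 = projT2 q1 & linear_part q2 = L e' f'].
  have [ff|/eqP ff] := eqVneq f f'; first by exists q1; rewrite -ff.
  case: s2 => // /n20.1 /(y_arc_edge hta ha1 h1b hbt)[k ky ek].
  have kj : k = j.
    by have [ki|//] := qij _ ek; move: ix ky; rewrite ki => /x_y_index.
  rewrite kj -zq1 in ek; have [q2 [? ? eq2]] := pi_edge ek.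
  exists q2; split=> //; rewrite eq2 eq1 Lj; congr L.
  by case: (f) (f') ff => -[].
rewrite -pq1 -pq2; apply: pi_lattice; first by rewrite zq2 zq1 zz.
by rewrite eq2 eq'.
Qed.

(** The two edge symmetries compose to the linear part -1, which preserves all copied normals. So
    two copies meeting at the vertex contain distinct points, arbitrarily close to it, with the same
    normal. *)
Lemma branch_point_vertex i j p v : projT2 p = line_vertex v ->
  edge i (line_vertex v) -> edge j (line_vertex v) ->
  sym_x i (+) sym_x j -> sym_y i (+) sym_y j -> sym_z i (+) sym_z j ->
  branch_point (@gauss_map R a b t rho) (\pi_S p).
Proof.
move=> pv ei ej ijx ijy ijz [U nU Uinj].
have [al [be [ga e0]]] := linear_partP p.
have [q1 [pq1 zq1 eq1]] : exists q, [/\ \pi_S q = \pi_S p, projT2 q = projT2 p &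
    linear_part q = (sym j).1 *m linear_part p] by apply: pi_edge; rewrite pv.
have [q2 [pq2 zq2 eq2]] : exists q, [/\ \pi_S q = \pi_S q1, projT2 q = projT2 q1 &
    linear_part q = (sym i).1 *m linear_part q1] by apply: pi_edge; rewrite zq1 pv.
have eq : linear_part q2 = sign_mx R (~~ al) (~~ be) (~~ ga).
  rewrite eq2 eq1 e0 !edge_symmetry_linear ?(edge_range ei) ?(edge_range ej)//.
  by rewrite !sign_mxM !addbA ijx ijy ijz.
(* The curve v + i |r| enters the copy from its vertex; the absolute value keeps it in the half
   plane on both sides of r = 0. *)
have near_curve q : \pi_S q = \pi_S p -> projT2 q = line_vertex v ->
    forall g (Gg : Gamma g), q = copy Gg (projT2 q) ->
    \forall r \near (0 : R), U (\pi_S (copy Gg (Some (half_plane_point v (normr_ge0 r))))).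
  move=> qp qv g Gg eqg.
  have pic : continuous \pi_S by exact: pi_continuous.
  have nq : nbhs q (\pi_S @^-1` U) by apply: (pic q U); rewrite qp.
  rewrite eqg qv in nq.
  have cv : continuous (fun r : R => half_plane_point v (normr_ge0 r)).
    apply: (@continuous_half_plane_point R (cst v)) => r; first exact: cvg_cst.
    exact: norm_continuous.
  have hv : half_plane_point v (normr_ge0 (0 : R)) = half_plane_point v (lexx 0).
    by apply: half_plane_point_inj => //; rewrite normr0.
  have cv0 : half_plane_point v (normr_ge0 r) @[r --> (0 : R)] -->
      half_plane_point v (lexx 0).
    by rewrite -hv; exact: cv.
  by apply: (cv0 [set w | U (\pi_S (copy Gg (Some w)))]); exact: nq.
have [g [Gg eg]] := copyP p; have [h [Gh eh]] := copyP q2.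
have zq2v : projT2 q2 = line_vertex v by rewrite zq2 zq1.
have := @filterI _ _ (nbhs_filter (0 : R)) _ _ (near_curve p erefl pv g Gg eg)
  (near_curve q2 (etrans pq2 pq1) zq2v h Gh eh).
move=> /nbhs_ballP[e /= e_gt0 eU].
have [Ug Uh] : U (\pi_S (copy Gg (Some (half_plane_point v (normr_ge0 (e / 2)))))) /\
    U (\pi_S (copy Gh (Some (half_plane_point v (normr_ge0 (e / 2)))))).
  apply: eU; rewrite /ball /= sub0r normrN gtr0_norm ?divr_gt0//.
  by rewrite ltr_pdivrMr// ltr_pMr// ltr1n.
set z : hexagon R := Some _ in Ug Uh.
have zedge k : ~ edge k z.
  have n0 : `|e / 2| <> 0 by apply/eqP; rewrite normr_eq0 gt_eqF// divr_gt0.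
  by case: k => [|[|[|[|[|[|[|k]]]]]]] /= [] // => _ [].
have lg : linear_part (copy Gg z) = linear_part p by rewrite [in RHS]eg.
have lh : linear_part (copy Gh z) = linear_part q2 by rewrite [in RHS]eh.
have : \pi_S (copy Gg z) = \pi_S (copy Gh z).
  apply: Uinj; rewrite ?inE// !gauss_map_pi.
  have [n1 [n2 [n3 [en _ _ _ _]]]] := normal_spec ab hrho z.
  rewrite (@copies_normalE (copy Gg z) al be ga n1 n2 n3) ?lg//.
  rewrite (@copies_normalE (copy Gh z) (~~ al) (~~ be) (~~ ga) n1 n2 n3) ?lh//.
  by rewrite !addbN !addNb !negbK.
(* An invariant of the gluing that tells the two copies apart: z lies on no edge, so gluing
   preserves its linear part. Elsewhere 0 is a default value. *)
pose f q := (projT2 q, if pselect (projT2 q = z) then linear_part q else 0).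
have fadj q q' : adjacent q q' -> f q = f q'.
  rewrite /f => -[<- eL]; case: pselect => // zq; congr pair.
  by case: eL => [//|[k]]; rewrite zq => /zedge.
have fz q : projT2 q = z -> (f q).2 = linear_part q by rewrite /f /=; case: pselect.
move=> /(Sigma_invariant fadj)/(congr1 snd).
rewrite !fz// lg lh e0 eq => /sign_mx_inj[+ _ _].
by case: (al).
Qed.

Lemma branched_valuesP v : branched_values (@gauss_map R a b t rho) v <->
  exists2 p : copies a b t rho,
    (exists2 u, u \in [:: - t; -1; 1; t] & projT2 p = line_vertex u) &
    v = copies_normal p.
Proof.
split=> [[s bs <-]|[p [u ut pu] ->]].
  exists (repr s) => //.
  have [//|[i [j [ix jy ij]]]] := arcs_cases hta ha1 h1b hbt (projT2 (repr s)).
  by have := not_branch_point ix jy ij; rewrite reprK => /(_ bs).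
exists (\pi_S p); last exact: gauss_map_pi.
move: hta ha1 h1b hbt => *.
move: ut pu; rewrite !inE => /or4P[] /eqP-> pu.
(* At each of the four vertices a straight segment (edge 3 or 6) meets an arc in a symmetry
   plane. *)
- apply: (@branch_point_vertex 6 1 p _ pu) => //=; rewrite /vertex /=.
    by split=> //; right; rewrite lexx.
  by split=> //; split=> //; lra.
- apply: (@branch_point_vertex 2 3 p _ pu) => //=; rewrite /vertex /=;
  by split=> //; split=> //; lra.
- apply: (@branch_point_vertex 3 4 p _ pu) => //=; rewrite /vertex /=;
  by split=> //; split=> //; lra.
- apply: (@branch_point_vertex 5 6 p _ pu) => //=; rewrite /vertex /=.
    by split=> //; split=> //; lra.
  by split=> //; left; rewrite lexx.
Qed.

End Surface.

(** * The eight branched values *)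

Section BranchedValues.
Variable R : realType.
Variables a b t rho : R.
Hypotheses (hta : - t < - a) (ha1 : - a < -1) (h1b : 1 < b) (hbt : b < t).
Hypothesis (hrho : 0 < rho).

Notation normal z := (inv_stereo (G_extended a b rho z)).

Let ab : 0 < a + b.
Proof. by move: hta ha1 h1b hbt => *; lra. Qed.

(* The distance to the vertical axis and the height of the point of the unit
   sphere with stereographic projection of modulus [g]. *)
Definition radius (g : R) := 2 * g / (g ^+ 2 + 1).
Definition level (g : R) := (g ^+ 2 - 1) / (g ^+ 2 + 1).

Lemma sqrD1_neq0 (g : R) : g ^+ 2 + 1 != 0.
Proof. by rewrite gt_eqF// ltr_wpDl// sqr_ge0. Qed.

Lemma radius_gt0 (g : R) : 0 < g -> 0 < radius g.
Proof. by move=> g0; rewrite divr_gt0 ?mulr_gt0 ?ltr_wpDl ?sqr_ge0. Qed.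

Lemma level_gt0 (g : R) : 1 < g ^+ 2 -> 0 < level g.
Proof. by move=> g1; rewrite divr_gt0 ?subr_gt0 ?ltr_wpDl ?sqr_ge0. Qed.

Lemma level_eq0 (g : R) : level g = 0 -> g ^+ 2 = 1.
Proof.
by move=> /eqP; rewrite mulf_eq0 invr_eq0 (negbTE (sqrD1_neq0 g)) orbF subr_eq0 => /eqP.
Qed.

(** The level is (m - 1) / (m + 1) with m = g^2; changing its sign means replacing m by 1 / m. *)
Lemma level_opp (g h : R) : level h = - level g -> g ^+ 2 * h ^+ 2 = 1.
Proof.
rewrite /level => e; have g0 := sqrD1_neq0 g; have h0 := sqrD1_neq0 h.
have : (h ^+ 2 - 1) * (g ^+ 2 + 1) = - (g ^+ 2 - 1) * (h ^+ 2 + 1).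
  have -> : h ^+ 2 - 1 = (h ^+ 2 - 1) / (h ^+ 2 + 1) * (h ^+ 2 + 1) by field.
  by rewrite e; field.
lra.
Qed.

(** The antipode of a value of modulus g has the level of g, which is then 0, or the level of h.
    Either both moduli are 1 or the levels are opposite. *)
Lemma level_antipodal (g h : R) : level g = 0 \/ level h = - level g ->
  level h = 0 \/ level g = - level h -> g ^+ 2 * h ^+ 2 = 1.
Proof.
move=> [/level_eq0 g1|/level_opp //] [/level_eq0 ->|/level_opp]; rewrite ?g1 ?mulr1 //.
by rewrite mul1r => ->.
Qed.

Lemma radius_levelV (g h : R) : g != 0 -> g * h = 1 ->
  radius h = radius g /\ level h = - level g.
Proof.
move=> g0 gh; have -> : h = g^-1 by apply: (mulfI g0); rewrite gh divff.
have h1 := sqrD1_neq0 g; have h2 := sqrD1_neq0 g^-1.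
have h3 : 1 + g ^+ 2 != 0 by rewrite addrC.
by rewrite /radius /level; split; field; rewrite g0 ?h1 ?h3.
Qed.

(** The reflections 1 and 2 already realize all signs of the first two coordinates. *)
Lemma symmetry_group_flip (s s' : bool) : exists2 g,
  symmetry_group a b t rho g & g.1 = sign_mx R s s' false.
Proof.
have G1 : symmetry_group a b t rho (if s then edge_symmetry a b t rho 1 else translation 0).
  case: s; last exact: Gamma1.
  have := GammaM (k := 1) (Gamma1 a b t rho) isT.
  by rewrite /isometry_comp /translation /= mulmx1 mulmx1 addr0.
exists (isometry_comp (if s then edge_symmetry a b t rho 1 else translation 0)
  (if s' then edge_symmetry a b t rho 2 else translation 0)).
  case: s'; first exact: GammaM.
  by rewrite /isometry_comp /translation /= mul1mx mul0mx add0r -surjective_pairing.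
have e1 (r : bool) (k : nat) : (0 < k <= 6)%N ->
    (if r then edge_symmetry a b t rho k else translation 0).1 =
    sign_mx R (r && sym_x k) (r && sym_y k) (r && sym_z k).
  by case: r => k6; [rewrite edge_symmetry_linear|rewrite /= sign_mx0].
rewrite -[LHS]/(_.1 *m (if s then _ else _).1) !e1// sign_mxM.
by case: s s' G1 => -[].
Qed.

Lemma vertex_normals u n1 n2 n3 (v : 'rV[R]_3) :
  normal (line_vertex u) = vec3 n1 n2 n3 ->
  (exists2 p : copies a b t rho, projT2 p = line_vertex u & v = copies_normal p) <->
  exists s s' : bool, v = vec3 ((-1) ^+ s * n1) ((-1) ^+ s' * n2) n3.
Proof.
move=> en; split=> [[p pu ->]|[s [s' ->]]].
  have [al [be [ga e]]] := linear_partP p.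
  exists (ga (+) al), (ga (+) be); apply: (copies_normalE e).
  by rewrite pu.
have [g Gg eg] := symmetry_group_flip s s'.
exists (copy Gg (line_vertex u)) => //.
by rewrite (@copies_normalE R a b t rho (copy Gg (line_vertex u)) s s' false n1 n2 n3).
Qed.

(** Here g_k = |G(v_k)|, and |G|^2 = rho^2 |z - b| / |z + a|. The values at v_1 and v_6 lie on the
    great circle x = 0, those at v_3 and v_4 on y = 0. *)
Lemma branched_values_explicit : exists g1 g3 g4 g6 : R,
  [/\ [/\ 0 < g1, 0 < g3, 0 < g4 & 0 < g6],
      g1 ^+ 2 = rho ^+ 2 * ((t + b) / (t - a)) /\
      g6 ^+ 2 = rho ^+ 2 * ((t - b) / (t + a)),
      g3 ^+ 2 = rho ^+ 2 * ((b + 1) / (a - 1)) /\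
      g4 ^+ 2 = rho ^+ 2 * ((b - 1) / (a + 1)) &
      forall v, branched_values (@gauss_map R a b t rho) v <->
        exists s : bool,
          (v = vec3 0 ((-1) ^+ s * radius g1) (level g1) \/
           v = vec3 0 ((-1) ^+ s * radius g6) (level g6)) \/
          (v = vec3 ((-1) ^+ s * radius g3) 0 (level g3) \/
           v = vec3 ((-1) ^+ s * radius g4) 0 (level g4))].
Proof.
move: (hta) (ha1) (h1b) (hbt) => h1 h2 h3 h4.
have d1 : 0 < t - a by lra.
have d2 : 0 < t + a by lra.
have d3 : 0 < a - 1 by lra.
have d4 : 0 < a + 1 by lra.
have q1 : (- t - b) / (- t + a) = (t + b) / (t - a).
  by rewrite -[RHS]mulrNN -invrN opprB opprD [a - t]addrC.
have q3 : (b - -1) / (-1 + a) = (b + 1) / (a - 1) by rewrite opprK [-1 + a]addrC.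
have q4 : (b - 1) / (1 + a) = (b - 1) / (a + 1) by rewrite [1 + a]addrC.
have [|g1 [g10 g1e n1]] := normal_vertex_x ab hrho (v := - t).
  by rewrite q1 divr_gt0//; lra.
have [|g6 [g60 g6e n6]] := normal_vertex_x ab hrho (v := t).
  by rewrite divr_gt0//; lra.
have [|g3 [g30 g3e n3]] := normal_vertex_y ab hrho (v := -1).
  by rewrite -[-1 - b]opprB mulNr q3 oppr_lt0 divr_gt0//; lra.
have [|g4 [g40 g4e n4]] := normal_vertex_y ab hrho (v := 1).
  by rewrite -[1 - b]opprB mulNr q4 oppr_lt0 divr_gt0//; lra.
exists g1, g3, g4, g6; split=> //.
- by rewrite g1e g6e q1.
- by rewrite g3e g4e q3 q4.
move=> v; rewrite branched_valuesP//.
have sN (s : bool) (x : R) : (-1) ^+ s * - x = (-1) ^+ (~~ s) * x.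
  by rewrite mulrN signrN mulNr.
split=> [[p [u ut pu] vp]|[s]].
  move: ut pu; rewrite !inE => /or4P[] /eqP-> pu.
  - have [|s [s' ->]] := (vertex_normals v n1).1; first by exists p.
    by exists s'; left; left; rewrite mulr0.
  - have [|s [s' ->]] := (vertex_normals v n3).1; first by exists p.
    by exists (~~ s); right; left; rewrite mulr0 sN.
  - have [|s [s' ->]] := (vertex_normals v n4).1; first by exists p.
    by exists (~~ s); right; right; rewrite mulr0 sN.
  - have [|s [s' ->]] := (vertex_normals v n6).1; first by exists p.
    by exists s'; left; right; rewrite mulr0.
case=> -[] ve.
- have [|p pu vp] := (vertex_normals v n1).2.
    by exists false, s; rewrite mulr0.
  by exists p => //; exists (- t) => //; rewrite !inE eqxx.
- have [|p pu vp] := (vertex_normals v n6).2.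
    by exists false, s; rewrite mulr0.
  by exists p => //; exists t => //; rewrite !inE eqxx !orbT.
- have [|p pu vp] := (vertex_normals v n3).2.
    by exists (~~ s), false; rewrite mulr0 sN negbK.
  by exists p => //; exists (-1) => //; rewrite !inE eqxx !orbT.
- have [|p pu vp] := (vertex_normals v n4).2.
    by exists (~~ s), false; rewrite mulr0 sN negbK.
  by exists p => //; exists 1 => //; rewrite !inE eqxx !orbT.
Qed.

(** * Antipodality of the eight values *)

Lemma antipodal_pairs_opp n (V : set 'rV[R]_3) (v : 'rV[R]_3) :
  antipodal_pairs n V -> V v -> V (- v).
Proof.
move=> [w [_ ->]] [[i e] _ <-]; exists (i, ~~ e) => //=.
by rewrite signrN scaleNr.
Qed.

Lemma antipodal_branched_values_eq :
  antipodal_pairs 4 (branched_values (@gauss_map R a b t rho)) -> a = b.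
Proof.
move=> anti; have [g1 [g3 [g4 [g6 [[g10 g30 g40 g60] [e1 e6] [e3 e4] VE]]]]] :=
  branched_values_explicit.
have [r1 r3 r4 r6] : [/\ 0 < radius g1, 0 < radius g3, 0 < radius g4 & 0 < radius g6].
  by split; exact: radius_gt0.
have opp v : branched_values (@gauss_map R a b t rho) v ->
  branched_values (@gauss_map R a b t rho) (- v) by exact: (antipodal_pairs_opp anti).
(* The antipode of a value on the circle x = 0 has nonzero second coordinate, so it comes from v_1
   or v_6 and has the level of g1 or g6. *)
have zx g : (g = g1 \/ g = g6) -> level g = - level g \/
    level g1 = - level g /\ g = g6 \/ level g6 = - level g /\ g = g1.
  move=> gg; have rg : 0 < radius g by case: gg => ->.
  have : branched_values (@gauss_map R a b t rho) (vec3 0 (radius g) (level g)).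
    apply/VE; exists false; left; rewrite expr0 !mul1r.
    by case: gg => ->; [left|right].
  move=> /opp/VE[s]; rewrite vec3N oppr0 => -[[]|[]] /vec3_inj[e e' e''].
  - by case: gg e'' => -> e''; [left; lra|right; left; split=> //; lra].
  - by case: gg e'' => -> e''; [right; right; split=> //; lra|left; lra].
  - by move: e' => /eqP; rewrite oppr_eq0 gt_eqF.
  - by move: e' => /eqP; rewrite oppr_eq0 gt_eqF.
have zy g : (g = g3 \/ g = g4) -> level g = - level g \/
    level g3 = - level g /\ g = g4 \/ level g4 = - level g /\ g = g3.
  move=> gg; have rg : 0 < radius g by case: gg => ->.
  have : branched_values (@gauss_map R a b t rho) (vec3 (radius g) 0 (level g)).
    apply/VE; exists false; right; rewrite expr0 !mul1r.
    by case: gg => ->; [left|right].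
  move=> /opp/VE[s]; rewrite vec3N oppr0 => -[[]|[]] /vec3_inj[e e' e''].
  - by move: e => /eqP; rewrite oppr_eq0 gt_eqF.
  - by move: e => /eqP; rewrite oppr_eq0 gt_eqF.
  - by case: gg e'' => -> e''; [left; lra|right; left; split=> //; lra].
  - by case: gg e'' => -> e''; [right; right; split=> //; lra|left; lra].
have p16 : g1 ^+ 2 * g6 ^+ 2 = 1.
  apply: level_antipodal.
    have [h|[[h _]|[h _]]] := zx g1 (or_introl erefl); [left|left|right]; lra.
  have [h|[[h _]|[h _]]] := zx g6 (or_intror erefl); [left|right|left]; lra.
have p34 : g3 ^+ 2 * g4 ^+ 2 = 1.
  apply: level_antipodal.
    have [h|[[h _]|[h _]]] := zy g3 (or_introl erefl); [left|left|right]; lra.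
  have [h|[[h _]|[h _]]] := zy g4 (or_intror erefl); [left|right|left]; lra.
move: (hta) (ha1) (h1b) (hbt) => h1 h2 h3 h4.
have nz : [/\ t - a != 0, t + a != 0, a - 1 != 0 & a + 1 != 0].
  by split; rewrite gt_eqF//; lra.
case: nz => d1 d2 d3 d4.
have f1 : rho ^+ 4 * ((t + b) * (t - b)) = (t - a) * (t + a).
  transitivity (g1 ^+ 2 * g6 ^+ 2 * ((t - a) * (t + a))); last by rewrite p16 mul1r.
  by rewrite e1 e6; field; rewrite d1 d2.
have f2 : rho ^+ 4 * ((b + 1) * (b - 1)) = (a - 1) * (a + 1).
  transitivity (g3 ^+ 2 * g4 ^+ 2 * ((a - 1) * (a + 1))); last by rewrite p34 mul1r.
  by rewrite e3 e4; field; rewrite d3 d4.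
have r4n : rho ^+ 4 != 0 by rewrite expf_neq0// gt_eqF.
(* Cross-multiplying [f1] and [f2] cancels rho^4. *)
have key : (t ^+ 2 - 1) * ((a - b) * (a + b)) = 0.
  apply: (mulfI r4n); rewrite mulr0.
  transitivity (rho ^+ 4 * ((t + b) * (t - b)) * ((a - 1) * (a + 1)) -
    rho ^+ 4 * ((b + 1) * (b - 1)) * ((t - a) * (t + a))); first ring.
  by rewrite f1 f2; ring.
move/eqP: key; rewrite !mulf_eq0 subr_eq0 => /or3P[/eqP tt|/eqP|/eqP]; [|lra|lra].
have : 0 < (t - 1) * (t + 1) by rewrite mulr_gt0//; lra.
lra.
Qed.

(** For a = b and rho = 1 the formulas give g_1 g_6 = g_3 g_4 = 1, so within each pair the radii
    agree and the levels are opposite. *)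
Lemma branched_values_antipodal : a = b -> rho = 1 ->
  antipodal_pairs 4 (branched_values (@gauss_map R a b t rho)).
Proof.
move=> eab rho1.
have [g1 [g3 [g4 [g6 [[g10 g30 g40 g60] [e1 e6] [e3 e4] VE]]]]] :=
  branched_values_explicit.
move: (hta) (ha1) (h1b) (hbt) => h1 h2 h3 h4.
rewrite -eab rho1 expr1n !mul1r in e1 e3 e4 e6.
have nz : [/\ t - a != 0, t + a != 0, a - 1 != 0 & a + 1 != 0].
  by split; rewrite gt_eqF//; lra.
case: nz => d1 d2 d3 d4.
have prod1 (g h : R) : 0 < g -> 0 < h -> g ^+ 2 * h ^+ 2 = 1 -> g * h = 1.
  move=> g0 h0; rewrite -exprMn => /eqP.
  by rewrite sqrf_eq1 => /orP[/eqP//|/eqP]; have := mulr_gt0 g0 h0; lra.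
have p16 : g1 * g6 = 1 by apply: prod1 => //; rewrite e1 e6; field; rewrite d1 d2.
have p34 : g3 * g4 = 1 by apply: prod1 => //; rewrite e3 e4; field; rewrite d3 d4.
have [r6 l6] := radius_levelV (lt0r_neq0 g10) p16.
have [r4 l4] := radius_levelV (lt0r_neq0 g30) p34.
have l1 : 0 < level g1.
  by apply: level_gt0; rewrite e1 ltr_pdivlMr ?mul1r//; lra.
have l3 : 0 < level g3.
  by apply: level_gt0; rewrite e3 ltr_pdivlMr ?mul1r//; lra.
have r1 := radius_gt0 g10; have r3 := radius_gt0 g30.
rewrite r6 l6 r4 l4 in VE.
move: (radius g1) (radius g3) (level g1) (level g3) r1 r3 l1 l3 VE =>
  y x z1 z3 y0 x0 z10 z30 VE.
(* One value from each antipodal pair, chosen with positive height, so that the height of +-w shows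
   the sign. *)
pose ws := [:: vec3 0 y z1; vec3 0 (- y) z1; vec3 x 0 z3; vec3 (- x) 0 z3].
have wn m n : (m < 4)%N -> (n < 4)%N -> ws`_m = ws`_n -> m = n.
  move: m n => [|[|[|[|m]]]] [|[|[|[|n]]]] //= _ _ /vec3_inj[? ? ?]; exfalso; lra.
pose w (i : 'I_4) := ws`_i.
exists w; split.
  move=> [i e] [j e'] /=.
  have ee : (-1) ^+ e *: w i = (-1) ^+ e' *: w j -> e = e'.
    have wz k : exists x' y' z', w k = vec3 x' y' z' /\ 0 < z'.
      case: k => -[|[|[|[|//]]]] k; by do 3 eexists; split; first by [].
    have [x1 [y1 [c1 [-> c10]]]] := wz i; have [x2 [y2 [c2 [-> c20]]]] := wz j.
    rewrite !vec3Z => /vec3_inj[_ _].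
    by case: e; case: e' => //; rewrite ?expr0 ?expr1; lra.
  move=> h; have ew := ee h; rewrite -ew in h *; congr pair.
  move: h => /(scalerI (negbT (signr_eq0 R e))); clear ee ew.
  by move=> h; apply: val_inj; exact: wn (ltn_ord i) (ltn_ord j) h.
have mem_w n (e : bool) : (n < 4)%N ->
    range (fun ie : 'I_4 * bool => (-1) ^+ ie.2 *: w ie.1)
    ((-1) ^+ e *: ws`_n) by move=> n4; exists (Ordinal n4, e).
apply/seteqP; split=> [v /VE[s [[]|[]] ->]|v [[i e] _ <-]].
- by case: s; [have := mem_w 1%N false isT|have := mem_w 0%N false isT];
    rewrite /= expr0 scale1r ?expr1 ?mulN1r ?mul1r.
- by case: s; [have := mem_w 0%N true isT|have := mem_w 1%N true isT];
    rewrite /= !expr1 scaleN1r vec3N ?expr0 ?mulN1r ?mul1r ?opprK oppr0.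
- by case: s; [have := mem_w 3%N false isT|have := mem_w 2%N false isT];
    rewrite /= expr0 scale1r ?expr1 ?mulN1r ?mul1r.
- by case: s; [have := mem_w 2%N true isT|have := mem_w 3%N true isT];
    rewrite /= !expr1 scaleN1r vec3N ?expr0 ?mulN1r ?mul1r ?opprK oppr0.
- apply/VE; case: i => -[|[|[|[|//]]]] i; case: e; rewrite /w /= ?expr0 ?expr1 vec3Z.
  + by exists true; left; right; rewrite expr1 !mulN1r oppr0.
  + by exists false; left; left; rewrite expr0 !mul1r.
  + by exists false; left; right; rewrite expr0 !mulN1r oppr0 opprK mul1r.
  + by exists true; left; left; rewrite expr1 !mul1r mulN1r.
  + by exists true; right; right; rewrite expr1 !mulN1r oppr0.
  + by exists false; right; left; rewrite expr0 !mul1r.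
  + by exists false; right; right; rewrite expr0 !mulN1r oppr0 opprK mul1r.
  + by exists true; right; left; rewrite expr1 !mul1r mulN1r.
Qed.

End BranchedValues.

(** * The period condition for a = b *)

Section Periods.
Variable R : realType.
Local Open Scope complex_scope.
Notation mu := (@lebesgue_measure R).

(** Lebesgue measure is its own pushforward under negation. *)
Lemma ge0_integral_oppr (D : set R) (f : R -> \bar R) :
  measurable D -> measurable_fun D f -> (forall x, D x -> (0 <= f x)%E) ->
  (\int[mu]_(x in (-%R : R -> R) @^-1` D) f (- x)%R = \int[mu]_(x in D) f x)%E.
Proof.
move=> mD mf f0.
rewrite -(@ge0_integral_pushforward _ _ (measurableTypeR R) (measurableTypeR R) R
  (-%R : measurableTypeR R -> measurableTypeR R) _ mu D f)//; last first.
  by move=> x /set_mem/f0.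
by apply: eq_measure_integral => A mA AD; exact: lebesgue_measureN.
Qed.

(** For infinite X both sides are 0, since [fine] sends infinities to 0. *)
Lemma fineZ (s : R) (X : \bar R) : fine (s%:E * X)%E = s * fine X.
Proof.
case: X => [x//||] /=; rewrite mulr0; case: (ltrgt0P s) => [s0|s0|->].
- by rewrite gt0_muley ?lte_fin.
- by rewrite lt0_muley ?lte_fin.
- by rewrite mul0e.
- by rewrite gt0_muleNy ?lte_fin.
- by rewrite lt0_muleNy ?lte_fin.
- by rewrite mul0e.
Qed.

(** Covers infinite integrals as well, by [fineZ]; a negative s is handled by negating the
    integral. *)
Lemma ge0_RintegralZl (D : set R) (g : R -> R) (s : R) :
  measurable D -> measurable_fun D g -> (forall x, D x -> 0 <= g x) ->
  \int[mu]_(x in D) (s * g x) = s * \int[mu]_(x in D) g x.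
Proof.
move=> mD mg g0.
have mg' : measurable_fun D (EFin \o g) by exact/measurable_EFinP.
have pos r : 0 <= r -> (\int[mu]_(x in D) (r * g x)%:E =
    r%:E * \int[mu]_(x in D) (g x)%:E)%E.
  move=> r0; rewrite -ge0_integralZl_EFin//.
have [s0|s0] := leP 0 s; first by rewrite /Rintegral pos// fineZ.
rewrite -fineZ /Rintegral -[s]opprK EFinN mulNe -pos ?oppr_ge0 ?(ltW s0)//.
rewrite -integral_ge0N; first by congr fine; apply: eq_integral => x _; rewrite mulNr EFinN.
by move=> x Dx; rewrite lee_fin mulr_ge0 ?oppr_ge0 ?(ltW s0)// g0.
Qed.

(** The integrand is imaginary of constant sign, so the modulus passes inside the integral. *)
Lemma norm_integral_real_axis (D : set R) (f : R[i] -> R[i]) (g : R -> R) (s : R) :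
  measurable D -> measurable_fun D g -> (forall x, D x -> 0 <= g x) ->
  (forall x, D x -> f x%:C = 0 +i* (s * g x)) ->
  `|integral_real_axis D f| = (`|s| * \int[mu]_(x in D) g x)%:C.
Proof.
move=> mD mg g0 fE; rewrite /integral_real_axis.
rewrite (@eq_Rintegral _ _ _ mu D (cst 0)); last by move=> x /set_mem/fE ->.
rewrite [X in _ +i* X](@eq_Rintegral _ _ _ mu D (fun x => s * g x)); last first.
  by move=> x /set_mem/fE ->.
rewrite ge0_RintegralZl// /Rintegral integral0 /= normc_def /= expr0n add0r.
by rewrite sqrtr_sqr normrM [X in _ * X]ger0_norm// (Rintegral_ge0 mu g0).
Qed.

Variables a t rho : R.
Hypotheses (a1 : 1 < a) (at' : a < t) (rho0 : 0 < rho).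

Definition dh_density (x : R) : R := (Num.sqrt (x - 1) * Num.sqrt (x + 1) *
  Num.sqrt (t - x) * Num.sqrt (x + t))^-1.
(* |phi1| = rho zero_density and |phi2| = pole_density / rho on ]a, t[; the names
   refer to the behaviour at x = a. *)
Definition zero_density (x : R) : R := Num.sqrt (x - a) / Num.sqrt (x + a) * dh_density x.
Definition pole_density (x : R) : R := Num.sqrt (x + a) / Num.sqrt (x - a) * dh_density x.

Let sqrt_gt0 x : a < x < t -> [/\ 0 < Num.sqrt (x - 1), 0 < Num.sqrt (x + 1),
  0 < Num.sqrt (t - x), 0 < Num.sqrt (x + t) & 0 < Num.sqrt (x - a) /\ 0 < Num.sqrt (x + a)].
Proof. by move: a1 at' => ? ? /andP[? ?]; rewrite !sqrtr_gt0; split; try split; lra. Qed.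

Lemma dh_density_gt0 x : a < x < t -> 0 < dh_density x.
Proof. by move=> /sqrt_gt0[? ? ? ? _]; rewrite invr_gt0 !mulr_gt0. Qed.

Lemma zero_density_gt0 x : a < x < t -> 0 < zero_density x.
Proof.
by move=> h; have [_ _ _ _ [? ?]] := sqrt_gt0 h; rewrite mulr_gt0 ?divr_gt0 ?dh_density_gt0.
Qed.

Lemma pole_density_gt0 x : a < x < t -> 0 < pole_density x.
Proof.
by move=> h; have [_ _ _ _ [? ?]] := sqrt_gt0 h; rewrite mulr_gt0 ?divr_gt0 ?dh_density_gt0.
Qed.


(** * The forms on the two outer intervals *)

Lemma imag_neq0 : 'i != 0 :> R[i].
Proof. by rewrite eq_complex /= oner_eq0 andbF. Qed.

Lemma real_neq0 (x : R) : 0 < x -> x%:C != 0 :> R[i].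
Proof. by move=> x0; rewrite fmorph_eq0 gt_eqF. Qed.

Lemma i_real (x : R) : 'i * x%:C = 0 +i* x.
Proof. by simpc. Qed.

Lemma phi_imaginary (z : R[i]) (u v : R) : u != 0 ->
  G a a rho z = 'i * u%:C -> dh t z = v%:C ->
  phi1 a a t rho z = 0 +i* (u * v) /\ phi2 a a t rho z = 0 +i* (- (v / u)).
Proof.
move=> u0 Gz dz; rewrite /phi1 /phi2 Gz dz -!i_real; split.
  by rewrite -mulrA -rmorphM.
have uC : u%:C != 0 :> R[i] by rewrite fmorph_eq0.
have iu : 'i * u%:C != 0 by rewrite mulf_neq0 ?imag_neq0.
rewrite rmorphN rmorphM fmorphV /=; apply: (mulIf iu); rewrite divfK//.
rewrite mulrACA mulNr divfK// -expr2 sqr_i.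
by rewrite mulN1r opprK.
Qed.

Lemma real_complexB (x y : R) : x%:C - y%:C = (x - y)%:C.
Proof. by rewrite rmorphB. Qed.

Lemma real_complexD (x y : R) : x%:C + y%:C = (x + y)%:C.
Proof. by rewrite rmorphD. Qed.

Lemma real_complexB1 (x : R) : x%:C - 1 = (x - 1)%:C.
Proof. by rewrite rmorphB. Qed.

Lemma real_complexD1 (x : R) : x%:C + 1 = (x + 1)%:C.
Proof. by rewrite rmorphD. Qed.

Lemma G_right x : a < x < t ->
  G a a rho x%:C = 'i * (rho * (Num.sqrt (x - a) / Num.sqrt (x + a)))%:C.
Proof.
move=> h; have [_ _ _ _ [s5 s6]] := sqrt_gt0 h; move: a1 at' h => ? ? /andP[? ?].
rewrite /G real_complexB real_complexD !sqrtc_ge0_real; [|lra|lra].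
rewrite !rmorphM fmorphV; ring.
Qed.

(** Both radicands are negative and the factors i cancel. Compared with [G_right] the quotient is
    inverted: for a = b, x |-> -x exchanges the zero and the pole of G^2. *)
Lemma G_left x : a < x < t ->
  G a a rho (- x)%:C = 'i * (rho * (Num.sqrt (x + a) / Num.sqrt (x - a)))%:C.
Proof.
move=> h; have [_ _ _ _ [s5 s6]] := sqrt_gt0 h; move: a1 at' h => ? ? /andP[? ?].
rewrite /G real_complexB real_complexD !sqrtc_le0_real; [|lra|lra].
rewrite !rmorphM fmorphV (_ : - (- x + a) = x - a); last by ring.
rewrite (_ : - (- x - a) = x + a); last by ring.
by field; rewrite imag_neq0 real_neq0.
Qed.

(** Only z - t is negative, and -i / i = -1. *)
Lemma dh_right x : a < x < t -> dh t x%:C = (- dh_density x)%:C.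
Proof.
move=> h; have [s1 s2 s3 s4 _] := sqrt_gt0 h; move: a1 at' h => ? ? /andP[? ?].
rewrite /dh real_complexB1 real_complexD1 real_complexB real_complexD.
rewrite (@sqrtc_le0_real _ (x - t)) ?opprB; last lra.
rewrite !sqrtc_ge0_real; [|lra|lra|lra].
rewrite /dh_density rmorphN fmorphV !rmorphM /=.
by field; rewrite imag_neq0 !real_neq0.
Qed.

(** Three radicands are negative, and -i / i^3 = 1. *)
Lemma dh_left x : a < x < t -> dh t (- x)%:C = (dh_density x)%:C.
Proof.
move=> h; have [s1 s2 s3 s4 _] := sqrt_gt0 h; move: a1 at' h => ? ? /andP[? ?].
rewrite /dh real_complexB1 real_complexD1 real_complexB real_complexD.
rewrite (@sqrtc_ge0_real _ (- x + t)); last lra.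
rewrite !sqrtc_le0_real; [|lra|lra|lra].
rewrite (_ : - (- x - 1) = x + 1); last by ring.
rewrite (_ : - (- x + 1) = x - 1); last by ring.
rewrite (_ : - (- x - t) = x + t); last by ring.
rewrite (_ : - x + t = t - x); last by ring.
rewrite /dh_density fmorphV !rmorphM /=.
transitivity (- ('i ^+ 2)^-1 * ((Num.sqrt (x - 1))%:C * (Num.sqrt (x + 1))%:C *
  (Num.sqrt (t - x))%:C * (Num.sqrt (x + t))%:C)^-1 : R[i]); last first.
  by rewrite sqr_i invrN invr1 opprK mul1r.
by field; rewrite imag_neq0 !real_neq0.
Qed.

Lemma phi_right x : a < x < t ->
  phi1 a a t rho x%:C = 0 +i* (- rho * zero_density x) /\
  phi2 a a t rho x%:C = 0 +i* (rho^-1 * pole_density x).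
Proof.
move=> h; have [_ _ _ _ [s5 s6]] := sqrt_gt0 h.
have u0 : rho * (Num.sqrt (x - a) / Num.sqrt (x + a)) != 0.
  by rewrite gt_eqF// mulr_gt0// divr_gt0.
have [-> ->] := phi_imaginary u0 (G_right h) (dh_right h).
rewrite /zero_density /pole_density; split; congr (_ +i* _); first by ring.
by field; rewrite !gt_eqF.
Qed.

Lemma phi_left x : a < x < t ->
  phi1 a a t rho (- x)%:C = 0 +i* (rho * pole_density x) /\
  phi2 a a t rho (- x)%:C = 0 +i* (- rho^-1 * zero_density x).
Proof.
move=> h; have [_ _ _ _ [s5 s6]] := sqrt_gt0 h.
have u0 : rho * (Num.sqrt (x + a) / Num.sqrt (x - a)) != 0.
  by rewrite gt_eqF// mulr_gt0// divr_gt0.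
have [-> ->] := phi_imaginary u0 (G_left h) (dh_left h).
rewrite /zero_density /pole_density; split; congr (_ +i* _); first by ring.
by field; rewrite !gt_eqF.
Qed.

(** * Measurability and integrability of the densities *)

Lemma continuous_sqrt_affine (c d : R) : continuous (fun x : R => Num.sqrt (c * x + d)).
Proof.
move=> x; apply: (@continuous_comp _ _ _ (fun x : R => c * x + d) Num.sqrt).
  by apply: cvgD; [apply: cvgM; [exact: cvg_cst|exact: cvg_id]|exact: cvg_cst].
exact: sqrt_continuous.
Qed.

Lemma continuous_density (x : R) : a < x < t ->
  {for x, continuous zero_density} /\ {for x, continuous pole_density}.
Proof.
move=> h; have [s1 s2 s3 s4 [s5 s6]] := sqrt_gt0 h.
have cB c : {for x, continuous (fun y : R => Num.sqrt (y + c))}.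
  have := @continuous_sqrt_affine 1 c x.
  by under eq_fun do rewrite mul1r.
have ct : {for x, continuous (fun y : R => Num.sqrt (t - y))}.
  have := @continuous_sqrt_affine (-1) t x.
  by under eq_fun do rewrite mulN1r addrC.
have cd : {for x, continuous dh_density}.
  apply: cvgV; first by rewrite gt_eqF// !mulr_gt0.
  by apply: cvgM; [apply: cvgM; [apply: cvgM|]|]; [exact: cB|exact: cB|exact: ct|exact: cB].
by split; apply: cvgM => //; apply: cvgM; try exact: cB;
  apply: cvgV; rewrite ?gt_eqF//; exact: cB.
Qed.

Lemma measurable_density :
  measurable_fun `]a, t[ zero_density /\ measurable_fun `]a, t[ pole_density.
Proof.
by split; apply: subspace_continuous_measurable_fun => //;
  apply: continuous_in_subspaceT => x /set_mem /=; rewrite in_itv /= => h;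
  have [] := continuous_density h.
Qed.

Lemma measurable_density_oppr :
  measurable_fun `]- t, - a[ (fun x => zero_density (- x)) /\
  measurable_fun `]- t, - a[ (fun x => pole_density (- x)).
Proof.
by split; apply: subspace_continuous_measurable_fun => //;
  apply: continuous_in_subspaceT => x /set_mem /=; rewrite in_itv /= => h;
  apply: (@continuous_comp _ _ _ (-%R : R -> R)); try exact: opp_continuous;
  have [] // := @continuous_density (- x); rewrite ltrNr ltrNl andbC.
Qed.


Lemma continuous_inv_sqrt (x : R) : x < t ->
  {for x, continuous (fun y : R => (Num.sqrt (t - y))^-1)}.
Proof.
move=> xt; apply: cvgV; first by rewrite gt_eqF// sqrtr_gt0 subr_gt0.
have := @continuous_sqrt_affine (-1) t x.
by under eq_fun do rewrite mulN1r addrC.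
Qed.

Lemma is_derive_sqrt_opp (x : R) : x < t ->
  is_derive x (1 : R) (fun y : R => - 2 * Num.sqrt (t - y)) (Num.sqrt (t - x))^-1.
Proof.
move=> xt; have tx : 0 < t - x by rewrite subr_gt0.
have s0 : Num.sqrt (t - x) != 0 by rewrite gt_eqF// sqrtr_gt0.
have d1 : is_derive x (1 : R) (fun y : R => t - y) (-1).
  have := @is_deriveB R R R (cst t) id x 1 _ _ (is_derive_cst t x 1) (is_derive_id x 1).
  by rewrite sub0r.
have d2 := @is_derive1_comp R Num.sqrt (fun y : R => t - y) x _ _ (is_derive1_sqrt tx) d1.
have d3 := @is_deriveZ R R R _ (- 2) x 1 _ d2.
have -> : (fun y : R => - 2 * Num.sqrt (t - y)) =
    (- 2) \*: (Num.sqrt \o (fun y : R => t - y)).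
  by [].
suff <- : - 2 *: ((2 * Num.sqrt (t - x))^-1 * -1) = (Num.sqrt (t - x))^-1 by exact: d3.
by rewrite /GRing.scale /=; field.
Qed.

(** By the antiderivative -2 sqrt (t - x); the bound is uniform in s, which allows s to tend to
    t. *)
Lemma integral_inv_sqrt_le (s : R) : a < s -> s < t ->
  (\int[mu]_(x in `[a, s]) (Num.sqrt (t - x))^-1%:E <= (2 * Num.sqrt (t - a))%:E)%E.
Proof.
move=> as_ st.
rewrite (@continuous_FTC2 _ _ (fun y : R => - 2 * Num.sqrt (t - y)))//.
- rewrite -EFinB lee_fin; have := sqrtr_ge0 (t - s); lra.
- apply: continuous_in_subspaceT => x /set_mem /=; rewrite in_itv /= => /andP[_ xs].
  by apply: continuous_inv_sqrt; exact: le_lt_trans st.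
- have cF (x : R) : (fun y : R => - 2 * Num.sqrt (t - y)) @ x --> - 2 * Num.sqrt (t - x).
    apply: cvgM; first exact: cvg_cst.
    have := @continuous_sqrt_affine (-1) t x.
    by under eq_fun do rewrite mulN1r addrC.
  split.
  + move=> x; rewrite in_itv /= => /andP[_ xs].
    by have [] := is_derive_sqrt_opp (lt_trans xs st).
  + by apply: cvg_at_right_filter; exact: cF.
  + by apply: cvg_at_left_filter; exact: cF.
- move=> x; rewrite in_itv /= => /andP[_ xs].
  by rewrite derive1E; have [_ ->] := is_derive_sqrt_opp (lt_trans xs st).
Qed.

Lemma measurable_inv_sqrt :
  measurable_fun `[a, t[ (fun x : R => (Num.sqrt (t - x))^-1).
Proof.
apply: subspace_continuous_measurable_fun => //.
apply: continuous_in_subspaceT => x /set_mem /=; rewrite in_itv /= => /andP[_ xt].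
exact: continuous_inv_sqrt.
Qed.

Lemma integral_inv_sqrt_lty :
  (\int[mu]_(x in `[a, t[) (Num.sqrt (t - x))^-1%:E < +oo)%E.
Proof.
(* An exhaustion for monotone convergence; the shift to n + 2 keeps the right endpoint strictly
   above a. *)
pose F n : set R := `[a, t - (t - a) / n.+2%:R]%classic.
have ta : 0 < t - a by rewrite subr_gt0.
have Ft n x : F n x -> a <= x < t.
  rewrite /F /= in_itv /= => /andP[-> /le_lt_trans]; apply.
  by rewrite ltrBlDr ltrDl divr_gt0.
have bF : \bigcup_n F n = `[a, t[%classic.
  apply/seteqP; split=> [x [n _ /Ft]|x]; rewrite /= in_itv //= => /andP[ax xt].
  have tx : 0 < t - x by rewrite subr_gt0.
  pose n := Num.bound ((t - a) / (t - x)); exists n => //.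
  rewrite /F /= in_itv /= ax lerBrDl -lerBrDr ler_pdivrMr// mulrC -ler_pdivrMr//.
  have /ltW/le_trans := archi_boundP (divr_ge0 (ltW ta) (ltW tx)); apply.
  by rewrite ler_nat leqW// leqW.
rewrite -bF.
have mf : measurable_fun (\bigcup_n F n) (fun x : R => (Num.sqrt (t - x))^-1).
  by rewrite bF; exact: measurable_inv_sqrt.
have cv := @ge0_nondecreasing_set_cvg_integral _ (measurableTypeR R) R F
  (fun x : R => (Num.sqrt (t - x))^-1%:E) mu.
apply: (@le_lt_trans _ _ (2 * Num.sqrt (t - a))%:E); last exact: ltry.
apply: (cvge_le _ (cv _ _ _ _)).
- apply: nearW => n; apply: integral_inv_sqrt_le.
    by rewrite ltrBrDr -ltrBrDl ltr_pdivrMr// ltr_pMr// ltr1n.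
  by rewrite ltrBlDr ltrDl divr_gt0.
- move=> m n mn; apply/subsetPset => x; rewrite /F /= !in_itv /= => /andP[-> /le_trans]; apply.
  by rewrite lerD2l lerN2 ler_pM2l// lef_pV2 ?posrE// ler_nat.
- by move=> i; exact: measurable_itv.
- move=> i; apply/measurable_EFinP; apply: measurable_funS mf; last exact: bigcup_sup.
  by rewrite bF; exact: measurable_itv.
- by move=> i x _; rewrite lee_fin invr_ge0 sqrtr_ge0.
Qed.

(** Finiteness is part of making the real-valued integral positive, because [fine] sends infinity to
    0. *)
Lemma integral_zero_density : (0 < \int[mu]_(x in `]a, t[) (zero_density x)%:E < +oo)%E.
Proof.
move: (a1) (at') => h1 h2.
have [mz _] := measurable_density.
have mz' : measurable_fun `]a, t[ (EFin \o zero_density) by exact/measurable_EFinP.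
have z0 x : `]a, t[%classic x -> 0 <= zero_density x.
  by rewrite /= in_itv /= => /zero_density_gt0/ltW.
apply/andP; split.
  pose m := (a + t) / 2.
  (* On ]m, t[ the root of x - a is at least that of (t - a) / 2, and all roots in denominators are
     at most sqrt (2 t). *)
  pose c := Num.sqrt ((t - a) / 2) / Num.sqrt (2 * t) *
    (Num.sqrt (2 * t) * Num.sqrt (2 * t) * Num.sqrt (2 * t) * Num.sqrt (2 * t))^-1.
  have st : 0 < Num.sqrt (2 * t) by rewrite sqrtr_gt0; lra.
  have c0 : 0 < c.
    by rewrite !(mulr_gt0, divr_gt0, invr_gt0)// sqrtr_gt0; lra.
  have sub : (`]m, t[%classic : set R) `<=` `]a, t[%classic.
    by move=> x; rewrite /= !in_itv /= /m => /andP[? ?]; lra.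
  apply: (@lt_le_trans _ _ (\int[mu]_(x in `]m, t[) c%:E)%E).
    rewrite integral_cst//= lebesgue_measure_itv /= lte_fin.
    have -> : m < t by rewrite /m; lra.
    by rewrite -EFinB -EFinM lte_fin mulr_gt0// subr_gt0 /m; lra.
  apply: (@le_trans _ _ (\int[mu]_(x in `]m, t[) (zero_density x)%:E)%E).
    apply: ge0_le_integral => //.
    - by move=> x _; rewrite lee_fin ltW.
    - exact: measurable_funS mz'.
    - move=> x; rewrite /= in_itv /= => /andP[mx xt]; rewrite lee_fin.
      have h : a < x < t by rewrite /m in mx; lra.
      have [s1 s2 s3 s4 [s5 s6]] := sqrt_gt0 h; rewrite /m in mx.
      rewrite /c /zero_density /dh_density.
      rewrite ler_pM ?divr_ge0 ?invr_ge0 ?mulr_ge0 ?sqrtr_ge0//.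
        rewrite ler_pM ?invr_ge0 ?sqrtr_ge0//; first by rewrite ler_sqrt; lra.
        by rewrite lef_pV2 ?posrE// ler_sqrt; lra.
      rewrite lef_pV2 ?posrE ?mulr_gt0//.
      by rewrite !ler_pM ?mulr_ge0 ?sqrtr_ge0// ler_sqrt; lra.
  by apply: ge0_subset_integral.
have sa : 0 < Num.sqrt (a - 1) by rewrite sqrtr_gt0; lra.
pose f x := (Num.sqrt (t - x))^-1.
have mf : measurable_fun `[a, t[ (EFin \o f).
  by apply/measurable_EFinP; exact: measurable_inv_sqrt.
have f0 x : 0 <= f x by rewrite invr_ge0 sqrtr_ge0.
have sub : (`]a, t[%classic : set R) `<=` `[a, t[%classic.
  by move=> x; rewrite /= !in_itv /= => /andP[/ltW -> ->].
apply: (@le_lt_trans _ _ ((Num.sqrt (a - 1))^-1%:E * \int[mu]_(x in `[a, t[) (f x)%:E)%E).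
  rewrite -ge0_integralZl_EFin ?invr_ge0 ?(ltW sa)//; last by move=> x _; rewrite lee_fin.
  apply: (@le_trans _ _ (\int[mu]_(x in `]a, t[)
      ((Num.sqrt (a - 1))^-1%:E * (f x)%:E))%E); last first.
    apply: ge0_subset_integral => //; first exact: measurable_funeM.
    by move=> x _; rewrite -EFinM lee_fin mulr_ge0 ?invr_ge0 ?(ltW sa).
  apply: ge0_le_integral => //.
  - apply: measurable_funeM; exact: measurable_funS mf.
  - move=> x; rewrite /= in_itv /= => h; rewrite -EFinM lee_fin.
    have [s1 s2 s3 s4 [s5 s6]] := sqrt_gt0 h; move/andP: h => [ax xt].
    (* The quotient of roots is at most 1, the root of x - 1 is at least that of a - 1, and the
       roots of x + 1 and x + t are at least 1. *)
    rewrite /zero_density /dh_density /f -invfM -[leRHS]mul1r.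
    rewrite ler_pM ?divr_ge0 ?invr_ge0 ?mulr_ge0 ?sqrtr_ge0//.
      by rewrite ler_pdivrMr// mul1r ler_sqrt; lra.
    rewrite lef_pV2 ?posrE ?mulr_gt0//.
    have -> : Num.sqrt (a - 1) * Num.sqrt (t - x) =
      Num.sqrt (a - 1) * 1 * Num.sqrt (t - x) * 1 by rewrite !mulr1.
    have one y : 1 <= y -> 1 <= Num.sqrt y.
      by move=> y1; rewrite -[leLHS]sqrtr1 ler_sqrt//; lra.
    rewrite !ler_pM ?mulr_ge0 ?sqrtr_ge0//; first by rewrite ler_sqrt; lra.
    + by apply: one; lra.
    + by apply: one; lra.
by apply: lte_mul_pinfty; rewrite ?lee_fin ?invr_ge0 ?(ltW sa) ?integral_inv_sqrt_lty.
Qed.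

(** With H and K the integrals of the two densities, I_1 = rho H, I_5 = rho K, J_1 = K / rho and J_5
    = H / rho. The first condition becomes rho^2 (H + K) = H + K with H + K > 0. *)
Lemma period_conditions_rho : period_conditions a a t rho -> rho = 1.
Proof.
move=> [h _].
have [mz mp] := measurable_density; have [mz' mp'] := measurable_density_oppr.
have opp_itv x : `]- t, - a[%classic x -> a < - x < t.
  by rewrite /= in_itv /= => /andP[? ?]; rewrite ltrNr ltrNl; apply/andP.
have itv x : `]a, t[%classic x -> a < x < t by rewrite /= in_itv.
set H := \int[mu]_(x in `]a, t[) pole_density x.
set K := \int[mu]_(x in `]a, t[) zero_density x.
have oppE (f : R -> R) : measurable_fun `]a, t[ f ->
    (forall x, a < x < t -> 0 < f x) ->
    \int[mu]_(x in `]- t, - a[) f (- x) = \int[mu]_(x in `]a, t[) f x.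
  move=> mf f0; congr fine.
  rewrite -(@ge0_integral_oppr `]a, t[%classic (fun x => (f x)%:E))//.
  - by rewrite opp_preimage_itvbndbnd.
  - exact/measurable_EFinP.
  - by move=> x /itv/f0/ltW.
have I1 : I_ a a t rho 1 = (`|rho| * H)%:C.
  rewrite /I_ /vertex /= (norm_integral_real_axis (s := rho)
    (g := fun x => pole_density (- x)))//.
  - by rewrite oppE//; exact: pole_density_gt0.
  - by move=> x /opp_itv/pole_density_gt0/ltW.
  - by move=> x /opp_itv/phi_left[+ _]; rewrite opprK.
have I5 : I_ a a t rho 5 = (`|- rho| * K)%:C.
  rewrite /I_ /vertex /= (norm_integral_real_axis (g := zero_density) (s := - rho))//.
  - by move=> x /itv/zero_density_gt0/ltW.
  - by move=> x /itv/phi_right[].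
have J1 : J_ a a t rho 1 = (`|- rho^-1| * K)%:C.
  rewrite /J_ /vertex /= (norm_integral_real_axis (s := - rho^-1)
    (g := fun x => zero_density (- x)))//.
  - by rewrite oppE//; exact: zero_density_gt0.
  - by move=> x /opp_itv/zero_density_gt0/ltW.
  - by move=> x /opp_itv/phi_left[_]; rewrite opprK.
have J5 : J_ a a t rho 5 = (`|rho^-1| * H)%:C.
  rewrite /J_ /vertex /= (norm_integral_real_axis (g := pole_density) (s := rho^-1))//.
  - by move=> x /itv/pole_density_gt0/ltW.
  - by move=> x /itv/phi_right[].
(* H >= 0 holds even under the convention that an infinite integral has value 0; strictness of H + K
   > 0 comes from K. *)
have H0 : 0 <= H by apply: Rintegral_ge0 => x /itv/pole_density_gt0/ltW.
have K0 : 0 < K by apply: fine_gt0; exact: integral_zero_density.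
move: h; rewrite I1 I5 J1 J5 !normrN gtr0_norm// gtr0_norm ?invr_gt0//.
rewrite !real_complexD => -[e].
have e2 : (rho ^+ 2 - 1) * (H + K) = 0.
  have -> : (rho ^+ 2 - 1) * (H + K) = rho * (rho * H + rho * K) - (K + H) by ring.
  by rewrite e; field; rewrite gt_eqF.
move/eqP: e2; rewrite mulf_eq0 [H + K == 0]gt_eqF ?ltr_wpDl// orbF subr_eq0 sqrf_eq1.
by move=> /orP[/eqP//|/eqP]; have := rho0; lra.
Qed.

End Periods.

Theorem theorem3p2 (R : realType) (a b t rho : R)
  (hta : - t < - a) (ha1 : - a < -1) (h1b : 1 < b) (hbt : b < t)
  (hrho : 0 < rho) (hperiod : period_conditions a b t rho) :
  antipodal_pairs 4 (branched_values (@gauss_map R a b t rho)) <-> a = b.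
Proof.
split; first exact: antipodal_branched_values_eq.
move=> eab; apply: branched_values_antipodal => //.
rewrite -eab in hbt hperiod; apply: period_conditions_rho hperiod => //.
by rewrite ltrNr opprK in ha1.
Qed.
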